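(* Let $\Omega$ be a set with $\mathbb{D}\subset\Omega\subset\overline{\mathbb{D}}$ and let $\mathcal{E}$ be a weak*-closed subspace of $H^\infty$ consisting of functions continuously extendable to $\Omega$, such that for every $z\in\Omega$ the evaluation $E_z$ on $\mathcal{E}$ belongs to $\mathcal{Q}_{\mathcal{E}}$ and the map $\Omega\ni z\mapsto E_z\in\mathcal{Q}_{\mathcal{E}}$ is (norm-)continuous. Suppose furthermore that $\mathcal{Q}_{\mathcal{E}}$ admits an $\ell^1$-basis of the form $(E_{a_n})_{n\in\mathbb{N}}$ with $a_n\in\mathbb{T}\cap\Omega$ for all $n$. Then there exist strictly positive numbers $\tau_n$ ($n\in\mathbb{N}$) such that (i) the closed disks $\overline{\mathbb{D}}_{a_n,\tau_n}$ are pairwise disjoint, and (ii) for any sequence $(b_n)_n$ with $b_n\in\mathbb{D}\cap\mathbb{D}_{a_n,\tau_n}$ for all $n$, the sequence $(E_{b_n})_n$ is an $\ell^1$-basis for $\mathcal{Q}_{\mathcal{E}}$ (and consequently $(b_n)_n$ is an interpolating sequence).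
   Context: $\mathbb{D}$ is the open unit disk, $\mathbb{T}$ the unit circle; $\mathbb{D}_{a,r}$ and $\overline{\mathbb{D}}_{a,r}$ are the open and closed disks of center $a$ and radius $r$. $H^\infty$ is the space of bounded analytic functions on $\mathbb{D}$ with sup norm, the dual of $L^1/H^1_0$ under $\langle[f],h\rangle=\int_{\mathbb{T}}fh\,dm$ ($m$ normalized Lebesgue measure on $\mathbb{T}$, $L^1=L^1(m)$, $H^1_0$ the functions in the Hardy space $H^1$ vanishing at $0$); this defines its weak* topology. For a weak*-closed subspace $\mathcal{E}$ of $H^\infty$, $\mathcal{Q}_{\mathcal{E}}$ is its predual, i.e. the quotient of $L^1/H^1_0$ by the preannihilator of $\mathcal{E}$, identified with the weak*-continuous linear functionals on $\mathcal{E}$ with the functional norm. For $z\in\Omega$, $E_z$ is the functional $h\mapsto h(z)$ on $\mathcal{E}$, where $h$ also denotes its continuous extension to $\Omega$. A sequence $(x_n)_n$ in a Banach space $X$ is an $\ell^1$-basis if there is a Banach space isomorphism from $\ell^1$ onto $X$ sending the canonical unit vector $\epsilon_n$ to $x_n$ for all $n$. A sequence $(b_n)_n$ in $\mathbb{D}$ is interpolating if the map $h\mapsto(h(b_n))_n$ from $H^\infty$ to $\ell^\infty$ is onto. *)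

(* Defs.v *)
From HB Require Import structures.
From mathcomp Require Import all_boot all_order all_algebra.
From mathcomp Require Import complex.
From mathcomp Require Import all_classical all_reals all_analysis.

Set Implicit Arguments.
Unset Strict Implicit.
Unset Printing Implicit Defensive.

Import Order.TTheory GRing.Theory Num.Theory.
Import numFieldNormedType.Exports.

Local Open Scope classical_set_scope.
Local Open Scope ring_scope.
Local Open Scope complex_scope.

HB.instance Definition _ (R : rcfType) := GRing.ComAlgebra.copy R[i] R[i]^o.
HB.instance Definition _ (R : rcfType) := Vector.copy R[i] R[i]^o.
HB.instance Definition _ (R : rcfType) := PseudoPointedMetric.copy R[i] R[i]^o.
HB.instance Definition _ (R : rcfType) := NormedModule.copy R[i] R[i]^o.

Section Complex.
Context {R : realType}.
Local Notation C := R[i].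

Definition disk (a : C) (r : R) : set C := [set z | `|z - a| < r%:C].
Definition cdisk (a : C) (r : R) : set C := [set z | `|z - a| <= r%:C].
Definition unit_disk : set C := disk 0 1.
Definition unit_circle : set C := [set z | `|z| = 1].

Definition analytic_at (f : C -> C) (z0 : C) : Prop :=
  exists c : nat -> C, \forall z \near z0,
    series (fun k => c k * (z - z0) ^+ k) @ \oo --> f z.

Lemma normcE (z : C) : `|z| = (Normc.normc z)%:C.
Proof. by case: z. Qed.

Lemma normc_le (z : C) (M : R) : (`|z| <= M%:C) = (Normc.normc z <= M).
Proof. by rewrite normcE lecR. Qed.

Lemma normc_ge0 (z : C) : 0 <= Normc.normc z.
Proof. by rewrite -lecR -normcE normr_ge0. Qed.

Lemma normcD_le (x y : C) :
  Normc.normc (x + y) <= Normc.normc x + Normc.normc y.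
Proof. by rewrite -lecR rmorphD/= -!normcE ler_normD. Qed.

End Complex.

Section Hinf.
Variable R : realType.
Local Notation C := R[i].

(* Elements of H^oo are represented by functions on C vanishing off the disk,
   so that equality in [hinf] is equality on the disk. *)
Definition hinf_pred : {pred C -> C} := fun h : C -> C =>
  `[< [/\ forall z, unit_disk z -> analytic_at h z,
          exists M : R, forall z, unit_disk z -> `|h z| <= M%:C
        & forall z, ~ unit_disk z -> h z = 0] >].

Lemma hinf_submod_closed : submod_closed hinf_pred.
Proof.
split.
  apply/asboolP; split => //.
  - move=> z _; exists (fun=> 0); apply: (@filterE _ (nbhs z)) => w.
    rewrite (_ : series _ = fun=> 0); first exact: cvg_cst.
    apply/funext => n; rewrite /series/= big1// => k _.
    by rewrite mul0r.
  - by exists 0 => z _; rewrite normr0.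
move=> a f g /asboolP[fa [M fM] f0] /asboolP[ga [N gN] g0].
apply/asboolP; split.
- move=> z Dz; have [c fc] := fa z Dz; have [d gd] := ga z Dz.
  exists (fun k => a * c k + d k).
  apply: filterS2 fc gd => w fw gw.
  rewrite (_ : series _ = (fun n => a *: series (fun k => c k * (w - z) ^+ k) n
    + series (fun k => d k * (w - z) ^+ k) n)).
    exact: cvgD (cvgZ (cvg_cst _) fw) gw.
  apply/funext => n /=; rewrite /series/= [in RHS]scaler_sumr.
  rewrite -big_split/=; apply: eq_bigr => k _.
  by rewrite mulrDl -mulrA.
- exists (Normc.normc a * M + N) => z Dz.
  rewrite rmorphD rmorphM/= -normcE (le_trans (ler_normD _ _))// lerD//.
    by rewrite normrZ ler_wpM2l// fM.
  exact: gN.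
- by move=> z Dz; rewrite !fctE f0// g0// scaler0 addr0.
Qed.

HB.instance Definition _ :=
  GRing.isSubmodClosed.Build C (C -> C) hinf_pred hinf_submod_closed.

Record hinf := Hinf { hinf_fun :> C -> C; _ : hinf_fun \in hinf_pred }.
HB.instance Definition _ := [isSub for hinf_fun].
HB.instance Definition _ := [Choice of hinf by <:].
HB.instance Definition _ := [SubChoice_isSubLmodule of hinf by <:].

Definition hinf_norm (h : hinf) : R :=
  sup [set Normc.normc (h z) | z in unit_disk].

End Hinf.

Section WeakStar.
Variable R : realType.
Local Notation C := R[i].

(* Integrals over the circle against normalized Lebesgue measure are written
   in the parametrization t |-> e^{it}, 0 <= t <= 2 pi. *)
Definition cis (t : R) : C := cos t +i* sin t.

Definition L1_circle (f : C -> C) : Prop :=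
  (@lebesgue_measure R).-integrable `[0, 2 * pi]
    (fun t => (complex.Re (f (cis t)))%:E) /\
  (@lebesgue_measure R).-integrable `[0, 2 * pi]
    (fun t => (complex.Im (f (cis t)))%:E).

Definition circle_integral (g : C -> C) : C :=
  ((2 * pi)^-1 *
     \int[@lebesgue_measure R]_(t in `[0, 2 * pi]) complex.Re (g (cis t))) +i*
  ((2 * pi)^-1 *
     \int[@lebesgue_measure R]_(t in `[0, 2 * pi]) complex.Im (g (cis t))).

(* Radial boundary values. By Fatou's theorem the limit exists at almost every
   point of the circle; at the other points [lim] has a default value. *)
Definition radial_limit (h : C -> C) (zeta : C) : C :=
  lim (h (r%:C * zeta) @[r --> (1 : R)^'-]).

Definition pairing (f : C -> C) (h : hinf R) : C :=
  circle_integral (fun zeta => f zeta * radial_limit h zeta).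

(* The weak* topology: the coarsest one making h |-> <[f], h> continuous for
   every f in L^1. As <[f], h> depends only on f modulo H^1_0, letting f range
   over L^1 gives the same topology as letting [f] range over L^1/H^1_0. *)
Definition pairing_map (h : hinf R) : {ptws {f | L1_circle f} -> C} :=
  fun f => pairing (sval f) h.

Definition weakstar : topologicalType := initial_topology pairing_map.

End WeakStar.

Section Predual.
Variables (R : realType) (E : submodClosed (hinf R)).
Local Notation C := R[i].

Record space_of := SpaceOf { space_val :> hinf R; _ : space_val \in E }.
HB.instance Definition _ := [isSub for space_val].
HB.instance Definition _ := [Choice of space_of by <:].
HB.instance Definition _ := [SubChoice_isSubLmodule of space_of by <:].

Definition weakstar_on : topologicalType :=
  initial_topology (space_val : space_of -> weakstar R).

(* The predual, as the space of weak*-continuous linear functionals. *)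
Definition predual_pred : {pred space_of -> C} := fun phi : space_of -> C =>
  `[< linear phi /\ continuous (phi : weakstar_on -> C) >].

End Predual.

Arguments predual_pred {R} E.

Section Bounds.
Variable R : realType.
Local Notation C := R[i].
Local Notation mu := (@lebesgue_measure R).

Lemma unit_disk0 : (@unit_disk R) 0.
Proof. by rewrite /unit_disk /disk /= subr0 normr0 ltcR. Qed.

Lemma hinf_bounded (h : hinf R) :
  has_sup [set Normc.normc (h z) | z in (@unit_disk R)].
Proof.
split; first by exists (Normc.normc (h 0)), 0 => //; exact: unit_disk0.
case: h => h /= /asboolP[_ [M hM] _].
by exists M => _ [z Dz <-]; rewrite -normc_le hM.
Qed.

Lemma hinf_norm_ub (h : hinf R) (z : C) : Normc.normc (h z) <= hinf_norm h.
Proof.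
have ub w : unit_disk w -> Normc.normc (h w) <= hinf_norm h.
  move=> Dw; apply: ub_le_sup; first by have [] := hinf_bounded h.
  by exists w.
have [|Dz] := pselect (unit_disk z); first exact: ub.
case: h ub => h hh ub; case/asboolP: (hh) => _ _ /= -> //.
by rewrite Normc.normc0 (le_trans _ (ub _ unit_disk0))// normc_ge0.
Qed.

Lemma hinf_norm_le (h : hinf R) (M : R) :
  (forall z, Normc.normc (h z) <= M) -> hinf_norm h <= M.
Proof.
move=> hM; apply: ge_sup; first by have [] := hinf_bounded h.
by move=> _ [z _ <-].
Qed.

Lemma hinf_normZ (a : C) (h : hinf R) :
  hinf_norm (a *: h) <= Normc.normc a * hinf_norm h.
Proof.
apply: hinf_norm_le => z; rewrite [(a *: h : hinf R) z]/=.
rewrite [X in Normc.normc X](_ : _ = a * h z) // Normc.normcM.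
by rewrite ler_wpM2l ?normc_ge0// hinf_norm_ub.
Qed.

Lemma radial_limit_bound (h : C -> C) (M : R) zeta :
  0 <= M -> (forall z, Normc.normc (h z) <= M) ->
  Normc.normc (radial_limit h zeta) <= M.
Proof.
move=> M0 hM; rewrite /radial_limit.
have [hl|/dvgP ->] := pselect (cvg (h (r%:C * zeta) @[r --> (1 : R)^'-])); last first.
  by rewrite [point](_ : _ = 0 :> C)// Normc.normc0.
move: hl; set l := lim _ => hl; rewrite leNgt; apply/negP => Ml.
have e0 : 0 < (Normc.normc l - M)%:C :> C by rewrite ltcR subr_gt0.
have /cvgrPdist_lt/(_ _ e0)/filter_ex[r] := hl.
rewrite normcE ltcR ltNge => /negP; apply.
rewrite lerBlDr; set w := h _.
rewrite -[X in Normc.normc X <= _](subrK w l).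
by rewrite (le_trans (normcD_le _ _))// lerD2l hM.
Qed.

Lemma Re_le (z : C) : `|complex.Re z| <= Normc.normc z.
Proof.
by case: z => x y /=; rewrite -(sqrtr_sqr x) ler_sqrt ?addr_ge0 ?sqr_ge0// lerDl sqr_ge0.
Qed.

Lemma Im_le (z : C) : `|complex.Im z| <= Normc.normc z.
Proof.
by case: z => x y /=; rewrite -(sqrtr_sqr y) ler_sqrt ?addr_ge0 ?sqr_ge0// lerDr sqr_ge0.
Qed.

Lemma normc_leD (z : C) : Normc.normc z <= `|complex.Re z| + `|complex.Im z|.
Proof.
case: z => x y /=.
rewrite -(ger0_norm (addr_ge0 (normr_ge0 x) (normr_ge0 y))) -sqrtr_sqr.
rewrite ler_sqrt ?sqr_ge0// sqrrD !real_normK ?num_real// lerD2r lerDl.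
by rewrite mulrn_wge0// mulr_ge0.
Qed.


(* No measurability: [pairing f h] is bounded below without showing that
   radial limits are measurable. *)
Lemma le_integral_nomeas (D : set R) (f g : R -> \bar R) :
  (forall x, D x -> 0 <= f x)%E -> (forall x, D x -> f x <= g x)%E ->
  (\int[mu]_(x in D) f x <= \int[mu]_(x in D) g x)%E.
Proof.
move=> f0 fg; have g0 x : D x -> (0 <= g x)%E.
  by move=> Dx; exact: le_trans (f0 x Dx) (fg x Dx).
rewrite !ge0_integralE//; apply: le_ereal_sup => _ [u /= uf <-].
exists u => //= x; apply: (le_trans (uf x)).
by rewrite /patch; case: ifPn => //; rewrite inE => /fg.
Qed.

Lemma Rintegral_bound (D : set R) (f : R -> R) (g : R -> \bar R) :
  (forall x, D x -> (`|f x|)%:E <= g x)%E ->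
  (\int[mu]_(x in D) g x < +oo)%E ->
  `|\int[mu]_(x in D) f x| <= fine (\int[mu]_(x in D) g x)%E.
Proof.
move=> fg goo; rewrite /Rintegral integralE.
set P := (\int[mu]_(x in D) (_ ^\+ x))%E; set N := (\int[mu]_(x in D) (_ ^\- x))%E.
have P0 : (0 <= P)%E by apply: integral_ge0.
have N0 : (0 <= N)%E by apply: integral_ge0.
set G := (\int[mu]_(x in D) g x)%E in goo *.
have PG : (P <= G)%E.
  apply: le_integral_nomeas => // x Dx; apply: le_trans (fg x Dx).
  by rewrite funeposE -EFin_max lee_fin ge_max ler_norm normr_ge0.
have NG : (N <= G)%E.
  apply: le_integral_nomeas => // x Dx; apply: le_trans (fg x Dx).
  by rewrite funenegE -EFinN -EFin_max lee_fin ge_max -normrN ler_norm normr_ge0.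
have Pf : P \is a fin_num by rewrite ge0_fin_numE// (le_lt_trans PG).
have Nf : N \is a fin_num by rewrite ge0_fin_numE// (le_lt_trans NG).
have Gf : G \is a fin_num by rewrite ge0_fin_numE// (le_trans P0).
rewrite fineB// ler_norml; apply/andP; split.
  by rewrite lerBrDr addrC lerBlDr ler_wpDl ?fine_ge0// fine_le.
by rewrite lerBlDr ler_wpDr ?fine_ge0// fine_le.
Qed.

Lemma pairing_bound (f : C -> C) : L1_circle f ->
  exists2 K : R, 0 <= K & forall (h : hinf R) (M : R), 0 <= M ->
    (forall z, Normc.normc (h z) <= M) -> Normc.normc (pairing f h) <= K * M.
Proof.
move=> [f1 f2]; set D : set R := `[0, 2 * pi]%classic.
set u := fun t : R => `|complex.Re (f (cis t))| + `|complex.Im (f (cis t))|.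
set I := (\int[mu]_(t in D) (u t)%:E)%E.
have ui : mu.-integrable D (EFin \o u).
  exact: (integrableD _ (integrable_norm f1) (integrable_norm f2)).
have I0 : (0 <= I)%E by apply: integral_ge0 => t _; rewrite lee_fin addr_ge0.
have Ioo : (I < +oo)%E.
  have /integrableP[_] := ui; apply: le_lt_trans.
  by apply: le_integral_nomeas => t Dt /=; rewrite lee_fin ?addr_ge0// ler_norm.
have If : I \is a fin_num by rewrite ge0_fin_numE.
have c0 : 0 <= (2 * pi)^-1 :> R by rewrite invr_ge0 mulr_ge0// pi_ge0.
exists (2 * ((2 * pi)^-1 * fine I)).
  by rewrite !mulr_ge0// fine_ge0.
move=> h M M0 hM.
have bnd t : Normc.normc (f (cis t) * radial_limit h (cis t)) <= u t * M.
  rewrite Normc.normcM ler_pM ?normc_ge0 ?normc_leD//.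
  exact: radial_limit_bound.
have gI : (\int[mu]_(t in D) (u t * M)%:E = I * M%:E)%E.
  exact: (@integralZr _ _ _ mu D (measurable_itv _) _ ui M).
have fI : fine (\int[mu]_(t in D) (u t * M)%:E)%E = fine I * M.
  by rewrite gI fineM.
have gIoo : (\int[mu]_(t in D) (u t * M)%:E < +oo)%E.
  by rewrite gI ltey_eq fin_numM.
rewrite (le_trans (normc_leD _))// /pairing /circle_integral /=.
rewrite !normrM (ger0_norm c0) -mulrDr -!mulrA mulrCA ler_wpM2l//.
rewrite -fI [leRHS]mulr_natl [leRHS]mulr2n lerD//; apply: Rintegral_bound => // t Dt;
  rewrite lee_fin (le_trans _ (bnd t))//; [exact: Re_le|exact: Im_le].
Qed.

End Bounds.

Lemma cvg_initial (S : choiceType) (T : topologicalType) (f : S -> T)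
    (F : set_system S) (s : S) : Filter F ->
  f x @[x --> F] --> f s -> F --> (s : initial_topology f).
Proof.
move=> FF fF A; rewrite nbhsE => -[_ [[B oB <-] Bs] BA].
have /fF : nbhs (f s) B by exact: open_nbhs_nbhs.
exact: (filterS BA).
Qed.

Section PredualNorm.
Variables (R : realType) (E : submodClosed (hinf R)).
Local Notation C := R[i].

Lemma predual_bounded (phi : space_of E -> C) : phi \in predual_pred E ->
  exists M : R, forall h : space_of E,
    hinf_norm h <= 1 -> Normc.normc (phi h) <= M.
Proof.
move=> /asboolP[lphi cphi]; apply: contrapT => /forallNP nb.
have /choice[u uP] : forall n : nat, exists h : space_of E,
    hinf_norm h <= 1 /\ n.+1%:R < Normc.normc (phi h).
  move=> n; have /existsNP[h /not_implyP[h1 /negP]] := nb n.+1%:R.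
  by rewrite -ltNge => h2; exists h.
have phiZ a h : phi (a *: h) = a * phi h.
  have phi0 : phi 0 = 0.
    by have := lphi (-1) 0 0; rewrite scaler0 addr0 scaleN1r addNr.
  by rewrite -[a *: h]addr0 lphi phi0 addr0.
pose c n : R := (n.+1%:R)^-1.
have c0 n : 0 < c n by rewrite invr_gt0.
have normc_c n : Normc.normc (c n)%:C = c n.
  by apply/complexI; rewrite -normcE ger0_norm// lecR ltW.
pose g n : space_of E := (c n)%:C *: u n.
have g0 : g @ \oo --> (0 : weakstar_on E).
  do 2 apply: cvg_initial; apply/cvg_sup => -[f Lf]; apply: cvg_initial.
  have [K K0 Kf] := pairing_bound Lf.
  have p0 : pairing_map (0 : hinf R) (exist _ f Lf) = 0.
    apply/Normc.eq0_normc/eqP; rewrite eq_le normc_ge0 andbT.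
    rewrite -(mulr0 K); apply: Kf => // z.
    by rewrite [X in Normc.normc X](_ : _ = 0)// Normc.normc0.
  suff pg0 : (fun n => pairing f (g n)) @ \oo --> (0 : C) by rewrite p0; exact: pg0.
  apply/cvgrPdist_le => e e0.
  have eE : e = (complex.Re e)%:C.
    by move: e0; rewrite ltcE/=; case: (e) => x y /= /andP[/eqP ->].
  have Re0 : 0 < complex.Re e by move: e0; rewrite eE ltcR.
  have Kc0 : (fun n => K * c n) @ \oo --> (0 : R).
    rewrite -[X in _ --> X](mulr0 K); apply: cvgM; first exact: cvg_cst.
    exact: cvg_harmonic.
  have /cvgrPdist_le/(_ _ Re0) Kce := Kc0.
  near=> n.
  have : `|0 - K * c n| <= complex.Re e by near: n; exact: Kce.
  rewrite sub0r normrN ger0_norm; last by rewrite mulr_ge0// ltW.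
  move=> Kc; rewrite sub0r normrN eE normc_le (le_trans _ Kc)//.
  apply: Kf; first exact: ltW.
  move=> z; rewrite [X in Normc.normc X](_ : _ = (c n)%:C * u n z)//.
  rewrite Normc.normcM normc_c ler_piMr ?(ltW (c0 _))//.
  by rewrite (le_trans (hinf_norm_ub _ _))// (uP n).1.
have phig : (phi \o g) @ \oo --> phi 0 by exact: (cvg_comp _ _ g0 (cphi 0)).
have phi0 : phi 0 = 0 by have := phiZ 0 0; rewrite scale0r mul0r.
move: phig; rewrite phi0 => /cvgrPdist_lt/(_ _ ltr01)/filter_ex[n].
rewrite sub0r normrN /= phiZ normcE -(rmorph1 (real_complex R)) ltcR.
rewrite Normc.normcM normc_c mulrC ltr_pdivrMr ?ltr0Sn// mul1r.
by move=> /lt_trans/(_ (uP n).2); rewrite ltxx.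
Unshelve. all: by end_near. Qed.

End PredualNorm.

Section PredualSpace.
Variables (R : realType) (E : submodClosed (hinf R)).
Local Notation C := R[i].

Lemma predual_submod_closed : submod_closed (predual_pred E).
Proof.
split.
  apply/asboolP; split; last exact: (@cst_continuous (weakstar_on E) C 0).
  by move=> a u v; rewrite scaler0 addr0.
move=> a f g /asboolP[lf cf] /asboolP[lg cg]; apply/asboolP; split.
  move=> b u v; rewrite !fctE lf lg !scalerDr !scalerA mulrC -!addrA.
  by congr (_ + _); rewrite addrCA.
by move=> h; exact: cvgD (cvgZ (cvg_cst _) (cf h)) (cg h).
Qed.

HB.instance Definition _ := GRing.isSubmodClosed.Build C (space_of E -> C)
  (predual_pred E) predual_submod_closed.

Record predual := Predual {
  predual_fun :> space_of E -> C ; _ : predual_fun \in predual_pred E }.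
HB.instance Definition _ := [isSub for predual_fun].
HB.instance Definition _ := [Choice of predual by <:].
HB.instance Definition _ := [SubChoice_isSubLmodule of predual by <:].

Definition predual_norm (phi : predual) : R :=
  sup [set Normc.normc (phi h) | h in [set h : space_of E | hinf_norm h <= 1]].

Lemma hinf_norm0_le1 : hinf_norm (0 : space_of E) <= 1.
Proof.
apply: hinf_norm_le => z.
by rewrite [X in Normc.normc X](_ : _ = 0)// Normc.normc0.
Qed.

Lemma predual_norm_ub (phi : predual) (h : space_of E) :
  hinf_norm h <= 1 -> Normc.normc (phi h) <= predual_norm phi.
Proof.
move=> h1; apply: ub_le_sup; last by exists h.
by have [M hM] := predual_bounded (valP phi); exists M => _ [k k1 <-]; exact: hM.
Qed.

Lemma predual_norm_le (phi : predual) (M : R) :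
  (forall h : space_of E, hinf_norm h <= 1 -> Normc.normc (phi h) <= M) ->
  predual_norm phi <= M.
Proof.
move=> phiM; apply: ge_sup => [|_ [h h1 <-]]; last exact: phiM.
by exists (Normc.normc (phi 0)), 0 => //; exact: hinf_norm0_le1.
Qed.

Lemma predual_norm_ge0 (phi : predual) : 0 <= predual_norm phi.
Proof.
exact: le_trans (normc_ge0 _) (predual_norm_ub phi hinf_norm0_le1).
Qed.

Lemma predual_normD (phi psi : predual) :
  (predual_norm (phi + psi))%:C <= (predual_norm phi)%:C + (predual_norm psi)%:C.
Proof.
rewrite -rmorphD lecR; apply: predual_norm_le => h h1.
by rewrite (le_trans (normcD_le _ _))// lerD// predual_norm_ub.
Qed.

Lemma predual_normZ_le (a : C) (phi : predual) :
  predual_norm (a *: phi) <= Normc.normc a * predual_norm phi.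
Proof.
apply: predual_norm_le => h h1.
rewrite [X in Normc.normc X](_ : _ = a * phi h)// Normc.normcM.
by rewrite ler_wpM2l ?normc_ge0// predual_norm_ub.
Qed.

Lemma predual_normZ (a : C) (phi : predual) :
  (predual_norm (a *: phi))%:C = `|a| * (predual_norm phi)%:C.
Proof.
rewrite normcE -rmorphM/=; congr (_%:C).
apply/eqP; rewrite eq_le predual_normZ_le/=.
have [->|a0] := eqVneq a 0.
  by rewrite Normc.normc0 mul0r predual_norm_ge0.
have na0 : 0 < Normc.normc a by rewrite -ltcR -normcE normr_gt0.
rewrite mulrC -ler_pdivlMr// mulrC -Normc.normcV.
by rewrite (le_trans _ (predual_normZ_le _ _))// scalerA mulVf// scale1r.
Qed.

Lemma predual_norm0_eq0 (phi : predual) : (predual_norm phi)%:C = 0 -> phi = 0.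
Proof.
move=> /complexI phi0.
have lphi : linear (predual_fun phi) by have /asboolP[] := valP phi.
have phiZ a h : phi (a *: h) = a * phi h.
  have p0 : phi 0 = 0.
    by have := lphi (-1) 0 0; rewrite scaler0 addr0 scaleN1r addNr.
  by rewrite -[a *: h]addr0 lphi p0 addr0.
apply/val_inj/funext => h /=; pose c : R := (1 + hinf_norm h)^-1.
have n0 : 0 <= hinf_norm h.
  exact: le_trans (normc_ge0 _) (hinf_norm_ub h 0).
have c0 : 0 < c by rewrite invr_gt0 ltr_pwDl.
have nc : Normc.normc c%:C = c.
  by apply/complexI; rewrite -normcE ger0_norm// lecR ltW.
have ch1 : hinf_norm (c%:C *: h) <= 1.
  rewrite (le_trans (hinf_normZ _ _))// nc /c mulrC ler_pdivrMr ?ltr_pwDl//.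
  by rewrite mul1r lerDr.
have := predual_norm_ub phi ch1; rewrite phi0 phiZ Normc.normcM nc.
rewrite pmulr_rle0// => ph0; apply/Normc.eq0_normc/eqP.
by rewrite eq_le ph0 normc_ge0.
Qed.

HB.instance Definition _ := Lmodule_isNormed.Build C predual
  predual_normD predual_normZ predual_norm0_eq0.

End PredualSpace.

Section Ell1.
Variable R : realType.
Local Notation C := R[i].

Definition ell1_pred : {pred nat -> C} := fun x : nat -> C =>
  `[< cvgn (series (fun n => Normc.normc (x n))) >].

Lemma ell1_submod_closed : submod_closed ell1_pred.
Proof.
split.
  apply/asboolP; rewrite (_ : series _ = cst 0); first exact: is_cvg_cst.
  by apply/funext => n; rewrite /series/= big1// => k _; exact: Normc.normc0.
move=> a x y /asboolP sx /asboolP sy; apply/asboolP.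
apply: (@series_le_cvg _ _
  ((fun n => Normc.normc a * Normc.normc (x n)) \+ (fun n => Normc.normc (y n)))).
- by move=> n; exact: normc_ge0.
- by move=> n; rewrite addr_ge0 ?mulr_ge0 ?normc_ge0.
- move=> n; rewrite (le_trans (normcD_le _ _))// lerD2r.
  by rewrite [X in Normc.normc X](_ : _ = a * x n)// Normc.normcM.
- by rewrite seriesD; apply: is_cvgD => //; exact: is_cvg_seriesZ.
Qed.

HB.instance Definition _ :=
  GRing.isSubmodClosed.Build C (nat -> C) ell1_pred ell1_submod_closed.

Record ell1 := Ell1 { ell1_fun :> nat -> C ; _ : ell1_fun \in ell1_pred }.
HB.instance Definition _ := [isSub for ell1_fun].
HB.instance Definition _ := [Choice of ell1 by <:].
HB.instance Definition _ := [SubChoice_isSubLmodule of ell1 by <:].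

Definition ell1_norm (x : ell1) : R :=
  limn (series (fun n => Normc.normc (x n))).

Lemma ell1_cvg (x : ell1) : cvgn (series (fun n => Normc.normc (x n))).
Proof. exact/asboolP/(valP x). Qed.

Lemma ell1_normD (x y : ell1) :
  (ell1_norm (x + y))%:C <= (ell1_norm x)%:C + (ell1_norm y)%:C.
Proof.
rewrite -rmorphD lecR /ell1_norm -limD; [|exact: ell1_cvg|exact: ell1_cvg].
apply: ler_lim; [exact: ell1_cvg| |].
  by apply: is_cvgD; exact: ell1_cvg.
apply: nearW => n; rewrite [leRHS](_ : _ =
  \sum_(0 <= k < n) (Normc.normc (x k) + Normc.normc (y k))); last first.
  by rewrite big_split.
by apply: ler_sum => k _; exact: normcD_le.
Qed.

Lemma ell1_normZ (a : C) (x : ell1) :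
  (ell1_norm (a *: x))%:C = `|a| * (ell1_norm x)%:C.
Proof.
rewrite normcE -rmorphM/=; congr (_%:C).
rewrite [RHS](_ : _ =
  Normc.normc a *: limn (series (fun n => Normc.normc (x n))))//.
rewrite -lim_seriesZ; last exact: ell1_cvg.
congr (limn (series _)); apply/funext => n.
by rewrite [X in Normc.normc X](_ : _ = a * x n)// Normc.normcM.
Qed.

Lemma ell1_norm0_eq0 (x : ell1) : (ell1_norm x)%:C = 0 -> x = 0.
Proof.
move=> /complexI x0; apply/val_inj/funext => n /=.
apply/Normc.eq0_normc/eqP; rewrite eq_le normc_ge0 andbT -x0.
have nd : nondecreasing_seq (series (fun n => Normc.normc (x n))).
  by apply: nondecreasing_series => k _ _; exact: normc_ge0.
apply: (@le_trans _ _ (series (fun n => Normc.normc (x n)) n.+1)); last first.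
  exact: (nondecreasing_cvgn_le nd (@ell1_cvg x)).
rewrite /series/= big_nat_recr//= lerDr sumr_ge0// => k _.
exact: normc_ge0.
Qed.

HB.instance Definition _ := Lmodule_isNormed.Build C ell1
  ell1_normD ell1_normZ ell1_norm0_eq0.

Lemma ell1_unit_subproof (n : nat) : (fun k => (k == n)%:R) \in ell1_pred.
Proof.
apply/asboolP; apply: nondecreasing_is_cvgn.
  by apply: nondecreasing_series => k _ _; exact: normc_ge0.
exists 1 => _ [m _ <-]; rewrite /series/=.
rewrite (eq_bigr (fun k => (k == n)%:R)); last first.
  by move=> k _; case: eqP => _; rewrite ?Normc.normc1 ?Normc.normc0.
have [nm|mn] := ltnP n m.
  rewrite (bigD1_seq n) ?mem_index_iota ?iota_uniq//= eqxx big1 ?addr0//.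
  by move=> k /negPf ->.
rewrite big_nat_cond big1 ?ler01// => k /andP[/andP[_ km] _].
by rewrite (ltn_eqF (leq_trans km mn)).
Qed.

Definition ell1_unit (n : nat) : ell1 := Ell1 (ell1_unit_subproof n).

End Ell1.

Section Statement.
Variable R : realType.
Local Notation C := R[i].

Definition is_l1_basis (X : normedModType C) (x : nat -> X) : Prop :=
  exists (T : {linear ell1 R -> X}) (S : {linear X -> ell1 R}),
    [/\ cancel T S, cancel S T, continuous T, continuous S &
        forall n, T (ell1_unit R n) = x n].

Definition is_extension (Omega : set C) (h g : C -> C) : Prop :=
  {within Omega, continuous g} /\ (forall z, unit_disk z -> g z = h z).

Definition extension (Omega : set C) (h : C -> C) : C -> C :=
  xget 0 [set g | is_extension Omega h g].

Definition evaluation (Omega : set C) (E : submodClosed (hinf R)) (z : C) :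
  space_of E -> C := fun h => extension Omega h z.

(* The evaluation at z as an element of the predual; it is 0 by default when
   [evaluation Omega E z] does not belong to the predual. *)
Definition evalQ (Omega : set C) (E : submodClosed (hinf R)) (z : C) :
  predual E := insubd (0 : predual E) (evaluation Omega (E := E) z).

Definition interpolating (b : nat -> C) : Prop :=
  (forall n, unit_disk (b n)) /\
  forall w : nat -> C, (exists M : R, forall n, `|w n| <= M%:C) ->
    exists h : hinf R, forall n, h (b n) = w n.

End Statement.

Arguments evaluation {R} Omega E z.
Arguments evalQ {R} Omega E z.

(* Main.v *)
(* Near a_n the evaluations E_z stay close to E_(a_n), so choosing tau_n small
   makes (E_(b_n)) a uniformly small perturbation of (E_(a_n)). If T maps the
   unit vectors of l^1 to the E_(a_n), the operator mapping them to the E_(b_n) is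
   T (1 + B) with |B| <= 1/2, invertible by a Neumann series. As distinct
   E_(a_n) are at distance at least d > 0 from each other, the a_n are isolated
   from one another, and a third of the isolation radius gives disjoint disks.

   Interpolation avoids the duality between H^oo and L^1/H^1_0. The lower bound
   sum |c_n| <= K |sum c_n E_(b_n)| yields, by a separation argument in C^N,
   functions of E of norm at most K sup |w_n| that nearly interpolate
   w_0, ..., w_(N-1); a pointwise limit along an ultrafilter solves the whole
   problem. That the limit is analytic is Montel's theorem: a bounded function
   with local power series expansions is, on each disk, the sum of one power
   series whose coefficients obey Cauchy's estimates. Without contour integrals,
   these estimates come from averages over roots of unity, and the radius of
   convergence is enlarged by steps of a fixed size. *)
From HB Require Import structures.
Require Import Defs.
From mathcomp Require Import all_boot all_order all_algebra.
From mathcomp Require Import complex cyclic separable cyclotomic.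
From mathcomp Require Import all_classical all_reals all_analysis.
From mathcomp Require Import ring lra zify.

Set Implicit Arguments.
Unset Strict Implicit.
Unset Printing Implicit Defensive.

Import Order.TTheory GRing.Theory Num.Theory.
Import numFieldNormedType.Exports.

Local Open Scope classical_set_scope.
Local Open Scope ring_scope.
Local Open Scope complex_scope.

(** * Moduli and limits of complex numbers *)

Section NormC.
Variable R : realType.
Local Notation C := R[i].
Implicit Types (x y z : C) (e : R).
Local Notation nc := (@Normc.normc R).

Lemma normc_opp x : nc (- x) = nc x.
Proof. by case: x => a b /=; rewrite !sqrrN. Qed.

Lemma normc_distC x y : nc (x - y) = nc (y - x).
Proof. by rewrite -normc_opp opprB. Qed.

Lemma normcX x n : nc (x ^+ n) = nc x ^+ n.
Proof. by elim: n => [|n IH]; rewrite ?expr0 ?Normc.normc1// !exprS Normc.normcM IH. Qed.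

Lemma normc_real e : nc e%:C = `|e|.
Proof. by rewrite /= expr0n addr0 sqrtr_sqr. Qed.

Lemma normc_nat n : nc n%:R = n%:R.
Proof. by rewrite -(rmorph_nat (real_complex R)) normc_real normr_nat. Qed.

Lemma normc_sum I (r : seq I) (P : pred I) (F : I -> C) :
  nc (\sum_(i <- r | P i) F i) <= \sum_(i <- r | P i) nc (F i).
Proof.
elim/big_ind2 : _ => [|x1 x2 y1 y2 h1 h2|//]; first by rewrite Normc.normc0.
by rewrite (le_trans (normcD_le _ _))// lerD.
Qed.

Lemma normc_tri x y z : nc (x - z) <= nc (x - y) + nc (y - z).
Proof. by rewrite -[X in nc X <= _](_ : (x - y) + (y - z) = _) ?normcD_le// addrA subrK. Qed.

Lemma normc_sub_le x y : nc x - nc y <= nc (x - y).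
Proof. by rewrite lerBlDr -[X in nc X <= _](subrK y) normcD_le. Qed.

Lemma gt0_complexE (e : C) : 0 < e -> exists2 r : R, 0 < r & e = r%:C.
Proof.
case: e => x y; rewrite ltcE/= => /andP[/eqP -> x0].
by exists x.
Qed.

Lemma cvg_normcP T (F : set_system T) {FF : Filter F} (f : T -> C) (l : C) :
  f x @[x --> F] --> l <-> forall e : R, 0 < e -> \forall x \near F, nc (l - f x) < e.
Proof.
split=> [/cvgrPdist_lt h e e0|h].
  have e0' : 0 < e%:C by rewrite ltcR.
  by apply: filterS (h _ e0') => x; rewrite Defs.normcE ltcR.
apply/cvgrPdist_lt => _ /gt0_complexE[e e0 ->].
by apply: filterS (h _ e0) => x; rewrite Defs.normcE ltcR.
Qed.

Lemma cvg_normc T (F : set_system T) {FF : Filter F} (f : T -> C) (l : C) :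
  f x @[x --> F] --> l -> nc (f x) @[x --> F] --> nc l.
Proof.
move=> /cvg_normcP h; apply/cvgrPdist_lt => e e0.
apply: filterS (h _ e0) => x; apply: le_lt_trans.
by rewrite ler_norml normc_sub_le andbT lerNl opprB normc_distC normc_sub_le.
Qed.

Lemma near_le_lim T (F : set_system T) {FF : ProperFilter F} (f : T -> C) (l a : C) e :
  f x @[x --> F] --> l -> (\forall x \near F, nc (f x - a) <= e) -> nc (l - a) <= e.
Proof.
move=> fl fe; have : nc (f x - a) @[x --> F] --> nc (l - a).
  have /cvg_normcP fle := fl.
  apply/cvgrPdist_lt => d d0; apply: filterS (fle _ d0) => x; apply: le_lt_trans.
  have h1 := normc_tri (f x) l a; have h2 := normc_tri l (f x) a.
  by rewrite (normc_distC (f x) l) in h1; rewrite ler_norml; apply/andP; split; lra.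
move=> h; rewrite -(cvg_lim _ h)//; apply: limr_le => //.
by apply/cvg_ex; exists (nc (l - a)).
Qed.

(** Real and imaginary parts lie in the compact segment from -M to M, where ultrafilters converge.
    Limits along one ultrafilter exist for all bounded families at once, so no diagonal extraction
    is needed later. *)
Lemma ultra_bounded_cvg T (F : set_system T) {UF : UltraFilter F} (f : T -> C) (M : R) :
  (\forall x \near F, nc (f x) <= M) ->
  exists2 l : C, f x @[x --> F] --> l & nc l <= M.
Proof.
move=> fM.
have key (g : T -> R) : (\forall x \near F, `|g x| <= M) ->
    exists l : R, g x @[x --> F] --> l.
  move=> gM.
  have := @segment_compact R (- M) M; rewrite compact_ultra => /(_ (g @ F)) /=.
  case.
  (* The image of an ultrafilter is maximal: if A is not in it, the complement of A is, and no
     proper filter contains both. *)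
  - apply: Build_UltraFilter => G PG FG.
    apply/seteqP; split => // A GA.
    have [//|nA] := in_ultra_setVsetC (F := F) (g @^-1` A) UF.
    have GnA : G (~` A) by apply: FG.
    have : G (A `&` ~` A) by exact: filterI.
    by rewrite setICr => /filter_not_empty.
  - by apply: filterS gM => x; rewrite ler_norml /= in_itv.
  - by move=> l [_ gl]; exists l.
have [a fa] : exists l : R, complex.Re (f x) @[x --> F] --> l.
  by apply: key; apply: filterS fM => x; apply: le_trans; exact: Re_le.
have [b fb] : exists l : R, complex.Im (f x) @[x --> F] --> l.
  by apply: key; apply: filterS fM => x; apply: le_trans; exact: Im_le.
have fl : f x @[x --> F] --> a +i* b.
  apply/cvg_normcP => e e0; have e2 : 0 < e / 2 by rewrite divr_gt0.
  move/cvgrPdist_lt : fa => /(_ _ e2) fa; move/cvgrPdist_lt : fb => /(_ _ e2) fb.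
  apply: filterS2 fa fb => x; case: (f x) => u v fa fb.
  apply: le_lt_trans (normc_leD _) _ => /=.
  by rewrite [e]splitr ltrD.
exists (a +i* b) => //.
rewrite -[l in nc l]subr0; apply: near_le_lim fl _.
by apply: filterS fM => x; rewrite subr0.
Qed.

Lemma nbhs_normcP (z : C) (A : set C) :
  nbhs z A <-> exists2 e : R, 0 < e & forall w, nc (w - z) < e -> A w.
Proof.
split.
  move=> /nbhs_ballP[_ /= /gt0_complexE[e e0 ->] h].
  by exists e => // w we; apply: h; rewrite -ball_normE /= Defs.normcE ltcR normc_distC.
move=> [e e0 h]; apply/nbhs_ballP; exists e%:C => /=; first by rewrite ltcR.
by move=> w; rewrite -ball_normE /= Defs.normcE ltcR normc_distC; exact: h.
Qed.

Lemma unit_diskE z : unit_disk z = (nc z < 1) :> Prop.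
Proof. by rewrite /unit_disk /disk /= subr0 Defs.normcE ltcR. Qed.

(** X^n - 1 splits and is separable in characteristic zero, so it has n distinct roots; among n
    distinct n-th roots of unity one is primitive. *)
Lemma prim_root_exists n : (0 < n)%N -> exists z : C, n.-primitive_root z.
Proof.
move=> n_gt0; pose p : {poly C} := 'X^n - 1.
have [r Dp] := closed_field_poly_normal p.
rewrite (monicP _) ?monicXnsubC // scale1r in Dp.
have rn1 : all n.-unity_root r.
  by apply/allP=> z; rewrite -root_prod_XsubC -Dp.
have sz_r : (n < (size r).+1)%N.
  by rewrite -(size_prod_XsubC r id) -Dp size_XnsubC.
have [|z] := hasP (has_prim_root n_gt0 rn1 _ sz_r); last by exists z.
by rewrite -separable_prod_XsubC -Dp separable_Xn_sub_1 // pnatr_eq0 -lt0n.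
Qed.

End NormC.

(** * Power series *)

Section PowerSeries.
Variable R : realType.
Local Notation C := R[i].
Local Notation nc := (@Normc.normc R).
Local Notation pseries c u := (series (fun k => c k * u ^+ k)).
Implicit Types (c d : nat -> C) (u v w z l : C) (rho s t M q : R) (f : C -> C).

(** Cauchy's estimates for the radius rho. They force geometric convergence on the open disk, and
    they pass to limits of the coefficients with the same M. *)
Definition coef_bound c rho M := forall k, nc (c k) * rho ^+ k <= M.

Lemma coef_bound_ge0 c rho M : coef_bound c rho M -> 0 <= M.
Proof. by move=> /(_ 0%N); apply: le_trans; rewrite expr0 mulr1 normc_ge0. Qed.

Lemma coef_bound_sub c rho s M : 0 <= s <= rho -> coef_bound c rho M -> coef_bound c s M.
Proof.
move=> /andP[s0 sr] cM k; apply: le_trans (cM k).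
by rewrite ler_wpM2l ?normc_ge0// lerXn2r// nnegrE// (le_trans s0).
Qed.

(** The terms are dominated by M q^k with q = |u| / rho. The bound depends on c only through M,
    which makes the convergence uniform over families of series. *)
Lemma pseries_partial c rho M u n m : 0 < rho -> coef_bound c rho M -> nc u < rho ->
  (n <= m)%N ->
  nc (pseries c u m - pseries c u n) <= M * ((nc u / rho) ^+ n / (1 - nc u / rho)).
Proof.
move=> rho0 cM ur nm; set q := nc u / rho.
have q0 : 0 <= q by rewrite divr_ge0 ?normc_ge0// ltW.
have q1 : q < 1 by rewrite ltr_pdivrMr// mul1r.
have q1' : 1 - q != 0 by rewrite subr_eq0 gt_eqF.
have M0 := coef_bound_ge0 cM.
have term k : nc (c k * u ^+ k) <= M * q ^+ k.
  rewrite Normc.normcM normcX; apply: le_trans (_ : nc (c k) * rho ^+ k * q ^+ k <= _).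
    by rewrite -mulrA -exprMn mulrCA mulfV ?mulr1// gt_eqF.
  by rewrite ler_wpM2r// exprn_ge0.
rewrite -(subnKC nm); set j := (m - n)%N.
(* The exact finite geometric sum is what the induction on [j] can carry. *)
apply: (@le_trans _ _ (M * ((q ^+ n - q ^+ (n + j)) / (1 - q)))); last first.
  rewrite ler_wpM2l// ler_wpM2r ?invr_ge0 ?subr_ge0 ?(ltW q1)//.
  by rewrite gerBl exprn_ge0.
elim: j => [|j IH]; first by rewrite addn0 !subrr mul0r mulr0 Normc.normc0.
rewrite addnS /series /= big_nat_recr//= -/(series _ _) addrAC.
rewrite (le_trans (normcD_le _ _))// (le_trans (lerD IH (term _)))//.
rewrite le_eqVlt; apply/orP; left; apply/eqP; rewrite exprS; field.
exact: q1'.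
Qed.

Lemma geometric_small M q e : 0 <= q < 1 -> 0 < e ->
  \forall n \near \oo, M * (q ^+ n / (1 - q)) < e.
Proof.
move=> /andP[q0 q1] e0.
have : (fun n => M / (1 - q) * q ^+ n) @ \oo --> M / (1 - q) * (0 : R).
  by apply: cvgM; [exact: cvg_cst|apply: cvg_expr; rewrite ger0_norm].
rewrite mulr0 => /cvgrPdist_lt/(_ _ e0); apply: filterS => n.
rewrite sub0r normrN; apply: le_lt_trans.
by rewrite (le_trans _ (ler_norm _))// [q ^+ n / _]mulrC mulrA.
Qed.

Lemma pseries_tail c rho M u l n : 0 < rho -> coef_bound c rho M -> nc u < rho ->
  pseries c u @ \oo --> l ->
  nc (l - pseries c u n) <= M * ((nc u / rho) ^+ n / (1 - nc u / rho)).
Proof.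
move=> rho0 cM ur cl; apply: near_le_lim cl _.
by exists n => // m /= nm; exact: (pseries_partial rho0 cM ur nm).
Qed.

Lemma ratio_lt1 u rho : 0 < rho -> nc u < rho -> 0 <= nc u / rho < 1.
Proof.
by move=> r0 ur; rewrite divr_ge0 ?normc_ge0 1?ltW//= ltr_pdivrMr// mul1r.
Qed.

Lemma pseries_cvg_of_tail c l u (e : nat -> R) :
  (forall n, nc (l - pseries c u n) <= e n) ->
  (forall r : R, 0 < r -> \forall n \near \oo, e n < r) -> pseries c u @ \oo --> l.
Proof.
move=> le e0; apply/cvg_normcP => r r0.
by apply: filterS (e0 _ r0) => n; exact: le_lt_trans (le n).
Qed.

(** Bounded partial sums converge along an ultrafilter; the tail estimate then upgrades this to
    ordinary convergence. *)
Lemma pseries_cvg c rho M u : 0 < rho -> coef_bound c rho M -> nc u < rho ->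
  exists l, pseries c u @ \oo --> l.
Proof.
move=> rho0 cM ur; have q01 := ratio_lt1 rho0 ur.
have [G [UG ooG]] := ultraFilterLemma (F := \oo : set_system nat) _.
have [|l cl _] := @ultra_bounded_cvg R _ G UG (pseries c u)
    (M * ((nc u / rho) ^+ 0 / (1 - nc u / rho))).
  apply: ooG; exists 0%N => // n _ /=.
  have := pseries_partial rho0 cM ur (leq0n n).
  by rewrite [X in _ - X]/series /= big_geq// subr0.
exists l; apply: pseries_cvg_of_tail (fun r r0 => geometric_small M q01 r0) => n.
apply: near_le_lim cl _; apply: ooG; exists n => // m /= nm.
exact: (pseries_partial rho0 cM ur nm).
Qed.

Lemma cvg_partial_sum T (F : set_system T) {FF : Filter F} (c : T -> nat -> C) d u n :
  (forall k, c i k @[i --> F] --> d k) ->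
  pseries (c i) u n @[i --> F] --> pseries d u n.
Proof.
move=> cd; elim: n => [|n IH].
  rewrite [X in _ --> X](_ : _ = 0); last by rewrite /series /= big_geq.
  apply/cvg_normcP => e e0; apply: nearW => i.
  by rewrite /series /= big_geq// subr0 Normc.normc0.
rewrite [X in _ --> X](_ : _ = pseries d u n + d n * u ^+ n); last first.
  by rewrite /series /= big_nat_recr.
rewrite (_ : (fun i => _) = (fun i => pseries (c i) u n + c i n * u ^+ n)); last first.
  by apply/funext => i; rewrite /series /= big_nat_recr.
by apply: cvgD IH _; exact: cvgM (cd n) (cvg_cst _).
Qed.

Lemma coef_bound_lim T (F : set_system T) {FF : ProperFilter F} (c : T -> nat -> C) d rho M :
  0 < rho -> (forall i, coef_bound (c i) rho M) ->
  (forall k, c i k @[i --> F] --> d k) -> coef_bound d rho M.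
Proof.
move=> rho0 cM cd k; rewrite -ler_pdivlMr ?exprn_gt0// -[d k]subr0.
apply: near_le_lim (cd k) _; apply: nearW => i.
by rewrite subr0 ler_pdivlMr ?exprn_gt0//; exact: cM.
Qed.

(** Tannery's theorem: the tails of all the series share one geometric bound, which survives the
    limit along F at each fixed truncation. *)
Lemma pseries_tannery T (F : set_system T) {FF : ProperFilter F} (c : T -> nat -> C) d rho M
    u (f : T -> C) l :
  0 < rho -> (forall i, coef_bound (c i) rho M) ->
  (forall k, c i k @[i --> F] --> d k) -> nc u < rho ->
  (forall i, pseries (c i) u @ \oo --> f i) -> f i @[i --> F] --> l ->
  pseries d u @ \oo --> l.
Proof.
move=> rho0 cM cd ur cf fl; have q01 := ratio_lt1 rho0 ur.
apply: pseries_cvg_of_tail (fun r r0 => geometric_small M q01 r0) => n.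
rewrite -[X in nc X]subr0.
have h : f i - pseries (c i) u n @[i --> F] --> l - pseries d u n.
  exact: cvgB fl (cvg_partial_sum cd).
apply: near_le_lim h _; apply: nearW => i; rewrite subr0.
exact: (pseries_tail n rho0 (cM i) ur (cf i)).
Qed.

(** A discrete Fourier transform: averaging p(s x^j) x^(-jk) over the n-th roots of unity, with n
    above the degree, isolates the k-th term without aliasing. *)
Lemma poly_cauchy (p : {poly C}) s M : 0 <= s ->
  (forall v, nc v = s -> nc p.[v] <= M) -> coef_bound (fun k => p`_k) s M.
Proof.
move=> s0 pM k.
have M0 : 0 <= M.
  by apply: le_trans (pM s%:C _); rewrite ?normc_ge0// normc_real ger0_norm.
have [pk|kp] := leqP (size p) k.
  by rewrite nth_default// Normc.normc0 mul0r.
set n := size p in kp; have n0 : (0 < n)%N by exact: leq_trans kp.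
have [x px] := prim_root_exists R n0.
have nx : nc x = 1.
  apply/eqP; rewrite -(@pexpr_eq1 _ _ n)// ?normc_ge0//.
  by rewrite -normcX prim_expr_order// Normc.normc1.
have nsx j : nc (s%:C * x ^+ j) = s.
  by rewrite Normc.normcM normcX nx expr1n mulr1 normc_real ger0_norm.
(* The exponent j (n - k) stands for -jk, since x^n = 1. *)
have eqS : \sum_(j < n) p.[s%:C * x ^+ j] * x ^+ (j * (n - k)) = n%:R * (p`_k * s%:C ^+ k).
  under eq_bigr do rewrite horner_coef mulr_suml.
  rewrite exchange_big /= (bigD1 (Ordinal kp))//= [X in _ + X]big1 ?addr0; last first.
    (* As l and k are distinct and below n, n does not divide l + n - k, so y differs from 1 while
       y^n = 1: its geometric sum vanishes. *)
    move=> l lk; set y := x ^+ (l + (n - k)).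
    rewrite (eq_bigr (fun j : 'I_n => p`_l * s%:C ^+ l * y ^+ j)); last first.
      move=> j _; rewrite exprMn -!exprM -!mulrA; congr (_ * (_ * _)).
      by rewrite -exprD -mulnDr mulnC.
    rewrite -mulr_sumr; suff -> : \sum_(j < n) y ^+ j = 0 by rewrite mulr0.
    have y1 : y - 1 != 0.
      rewrite subr_eq0 -(prim_order_dvd px); apply: contra lk => nlk.
      apply/eqP/val_inj => /=; have ln := ltn_ord l.
      by case/dvdnP: nlk => -[|[|j]]; move: kp ln; clearbody n; clear; nia.
    by apply: (mulfI y1); rewrite mulr0 -subrX1 /y -exprM mulnC exprM (prim_expr_order px) expr1n subrr.
  rewrite (eq_bigr (fun=> p`_k * s%:C ^+ k)).
    by rewrite sumr_const card_ord mulr_natl.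
  move=> j _; rewrite exprMn -!mulrA; congr (_ * _).
  by rewrite -exprM -exprD -mulnDr subnKC 1?ltnW// mulnC exprM (prim_expr_order px) expr1n mulr1.
have : nc (n%:R * (p`_k * s%:C ^+ k)) <= n%:R * M.
  rewrite -eqS (le_trans (normc_sum _ _ _))//.
  rewrite mulr_natl -[X in _ *+ X]card_ord -sumr_const ler_sum// => j _.
  by rewrite Normc.normcM normcX nx expr1n mulr1 pM.
rewrite !Normc.normcM normc_nat normcX normc_real ger0_norm//.
by rewrite ler_pM2l// ltr0n.
Qed.

Lemma exp_le_lim (a b rho : R) k : 0 < rho ->
  (forall s, 0 < s < rho -> a * s ^+ k <= b) -> a * rho ^+ k <= b.
Proof.
move=> rho0 h.
have : (a * s ^+ k) @[s --> rho^'-] --> a * rho ^+ k.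
  apply: cvgM; first exact: cvg_cst.
  apply: cvg_at_left_filter; exact: exprn_continuous.
move=> hl; rewrite -(cvg_lim _ hl)//; apply: limr_le; first by apply/cvg_ex; exists (a * rho ^+ k).
near=> s; apply: h; apply/andP; split; near: s; last exact: nbhs_left_lt.
exact: nbhs_left_gt.
Unshelve. all: by end_near. Qed.

Lemma horner_poly_coef c n u : (\poly_(i < n) c i).[u] = pseries c u n.
Proof. by rewrite horner_poly /series /= big_mkord. Qed.

(** The bound M' only serves to make truncations converge uniformly on circles of radius s < rho.
    There [poly_cauchy] bounds their coefficients by M + e; then e tends to 0 and s to rho. *)
Lemma pseries_cauchy c rho M' M (f : C -> C) : 0 < rho -> coef_bound c rho M' ->
  (forall u, nc u < rho -> pseries c u @ \oo --> f u) ->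
  (forall u, nc u < rho -> nc (f u) <= M) -> coef_bound c rho M.
Proof.
move=> rho0 cM' cf fM k; apply: exp_le_lim => // s /andP[s0 sr].
apply/ler_addgt0Pr => e e0.
have q01 : 0 <= s / rho < 1 by rewrite divr_ge0 ?ltW//= ltr_pdivrMr// mul1r.
near \oo => n.
have kn : (k < n)%N by near: n; exact: nbhs_infty_gt.
have -> : c k = (\poly_(i < n) c i)`_k by rewrite coef_poly kn.
apply: poly_cauchy; first exact: ltW.
move=> v vs; have vr : nc v < rho by rewrite vs.
rewrite horner_poly_coef -[X in nc X](subrK (f v)) addrC.
rewrite (le_trans (normcD_le _ _))// lerD ?fM// normc_distC.
rewrite (le_trans (pseries_tail n rho0 cM' vr (cf _ vr)))// vs ltW//.
by near: n; exact: geometric_small.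
Unshelve. all: by end_near. Qed.

(** The difference series sums to 0, so Cauchy's estimate with constant 0 kills its coefficients. *)
Lemma pseries_unique c d rho M M' (f : C -> C) : 0 < rho ->
  coef_bound c rho M -> coef_bound d rho M' ->
  (forall u, nc u < rho -> pseries c u @ \oo --> f u) ->
  (forall u, nc u < rho -> pseries d u @ \oo --> f u) -> c =1 d.
Proof.
move=> rho0 cM dM cf df k.
pose e k : C := c k - d k.
have e0 : coef_bound e rho 0.
  apply: (@pseries_cauchy e rho (M + M') 0 (fun=> 0) rho0).
  - move=> j; apply: le_trans (lerD (cM j) (dM j)).
    rewrite -mulrDl; apply: ler_wpM2r; first by rewrite exprn_ge0// ltW.
    by rewrite (le_trans (normcD_le _ _))// normc_opp.
  - move=> u ur; have /= := cvgB (cf u ur) (df u ur).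
    rewrite subrr => /(_ _); apply: cvg_trans; apply: near_eq_cvg; apply: nearW => n.
    rewrite fctE /series /= -sumrB; apply: eq_bigr => i _.
    by rewrite mulrBl.
  - by move=> u _; rewrite Normc.normc0.
apply/eqP; rewrite -subr_eq0; apply/eqP/Normc.eq0_normc/eqP.
rewrite eq_le normc_ge0 andbT -(mul0r (rho ^+ k)^-1) ler_pdivlMr ?exprn_gt0//.
exact: e0.
Qed.

End PowerSeries.

(** * Taylor expansion at a new center and enlargement of the radius of convergence *)

Section Recentering.
Variable R : realType.
Local Notation C := R[i].
Local Notation nc := (@Normc.normc R).
Local Notation pseries c u := (series (fun k => c k * u ^+ k)).
Implicit Types (c d : nat -> C) (u v w z l : C) (rho s t M q r delta : R) (f : C -> C).

Lemma cvg_seq_unique (x : nat -> C) l l' :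
  x @ \oo --> l -> x @ \oo --> l' -> l = l'.
Proof. exact: cvg_unique. Qed.

(** 'C(m + i, m) (rho - s)^m s^i is a single term of the binomial expansion of rho^(m + i), written
    as ((rho - s) + s)^(m + i). *)
Lemma binomial_coef_bound c rho s M m : 0 < s < rho -> coef_bound c rho M ->
  coef_bound (fun i => c (m + i)%N *+ 'C(m + i, m)) s (M / (rho - s) ^+ m).
Proof.
move=> /andP[s0 sr] cM i.
have d0 : 0 < rho - s by rewrite subr_gt0.
rewrite ler_pdivlMr ?exprn_gt0//; apply: le_trans (cM (m + i)%N).
rewrite -mulr_natr Normc.normcM normc_nat -!mulrA ler_wpM2l ?normc_ge0//.
have -> : rho ^+ (m + i) = ((rho - s) + s) ^+ (m + i) by rewrite subrK.
rewrite [leRHS]exprDn; set t := rho - s in d0 *.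
have mi : (i < (m + i).+1)%N by rewrite ltnS leq_addl.
rewrite (bigD1 (Ordinal mi))//= addnK -[X in X <= _]addr0 lerD//.
  have -> : 'C(m + i, i) = 'C(m + i, m) by rewrite -bin_sub ?leq_addl// addnK.
  by rewrite mulr_natl [s ^+ i * _]mulrC.
apply: sumr_ge0 => j _; rewrite mulrn_wge0// mulr_ge0// exprn_ge0//; exact: ltW.
Qed.

(** The m-th Taylor coefficient at w, that is the m-th derivative of the sum divided by m!. *)
Definition recenter c w (m : nat) : C :=
  lim (pseries (fun i => c (m + i)%N *+ 'C(m + i, m)) w @ \oo).

Lemma recenter_cvg c rho M w m : 0 < rho -> coef_bound c rho M -> nc w < rho ->
  pseries (fun i => c (m + i)%N *+ 'C(m + i, m)) w @ \oo --> recenter c w m.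
Proof.
move=> rho0 cM wr; pose s := (nc w + rho) / 2.
have s0 : 0 < s < rho.
  by have := normc_ge0 w; rewrite /s; lra.
have ws : nc w < s by rewrite /s; lra.
have [l cl] := pseries_cvg (proj1 (andP s0)) (binomial_coef_bound m s0 cM) ws.
by rewrite /recenter (cvg_lim _ cl).
Qed.

(** For truncations, Taylor expansion at w is a polynomial identity. They are bounded by M / (1 - s
    / rho) on the closed disk of radius s, so [poly_cauchy] bounds their coefficients at w
    uniformly, and Tannery's theorem gives the limit. *)
Lemma pseries_recenter c rho M w s : coef_bound c rho M -> nc w < s < rho ->
  coef_bound (recenter c w) (s - nc w) (M / (1 - s / rho)) /\
  forall u l, nc u < s - nc w -> pseries c (w + u) @ \oo --> l ->
    pseries (recenter c w) u @ \oo --> l.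
Proof.
move=> cM /andP[ws sr].
have s0 : 0 < s by apply: le_lt_trans ws; exact: normc_ge0.
have rho0 : 0 < rho by exact: lt_trans sr.
have M0 := coef_bound_ge0 cM.
pose p n := \poly_(i < n) c i.
pose e n k : C := (p n)^`N(k).[w].
have t0 : 0 < s - nc w by rewrite subr_gt0.
have pbound n v : nc v <= s -> nc (p n).[v] <= M / (1 - s / rho).
  move=> vs; have vr : nc v < rho by exact: le_lt_trans sr.
  have := pseries_partial rho0 cM vr (leq0n n).
  rewrite [X in _ - X]/series /= big_geq// subr0 horner_poly_coef expr0 div1r.
  move/le_trans; apply; rewrite ler_wpM2l// lef_pV2 ?posrE ?subr_gt0 ?ltr_pdivrMr ?mul1r//.
  by rewrite lerD2l lerN2 ler_wpM2r// invr_ge0 ltW.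
have eE n u : (p n).[w + u] = (\poly_(m < n) e n m).[u].
  rewrite (@nderiv_taylor_wide _ n) ?size_poly//; last exact: mulrC.
  by rewrite horner_poly.
have e_big n k : (n <= k)%N -> e n k = 0.
  by move=> nk; rewrite /e nderivn_poly0 ?horner0// (leq_trans (size_poly _ _)).
have ebound n : coef_bound (e n) (s - nc w) (M / (1 - s / rho)).
  have := @poly_cauchy R (\poly_(m < n) e n m) (s - nc w) (M / (1 - s / rho)) (ltW t0).
  move=> h k; have : coef_bound (fun k => (\poly_(m < n) e n m)`_k) (s - nc w) (M / (1 - s / rho)).
    apply: h => v vs; rewrite -eE; apply: pbound.
    by rewrite (le_trans (normcD_le _ _))// vs addrC subrK.
  move/(_ k); rewrite coef_poly; case: ltnP => // nk.
  by rewrite (e_big n k nk).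
have ecvg k : e n k @[n --> \oo] --> recenter c w k.
  (* After a shift by k, the k-th coefficient of the truncation at n + k is exactly the n-th partial
     sum of the series defining [recenter]. *)
  rewrite -(cvg_shiftn k); have := recenter_cvg (m := k) rho0 cM (lt_trans ws sr).
  apply: cvg_trans; apply: near_eq_cvg; apply: nearW => n.
  rewrite /= /e (@horner_coef_wide _ n); last first.
    apply/leq_sizeP => j nj; rewrite coef_nderivn coef_poly ltnNge.
    by rewrite addnC leq_add2l nj mul0rn.
  rewrite /series /= big_mkord; apply: eq_bigr => i _.
  by rewrite coef_nderivn coef_poly addnC ltn_add2r ltn_ord.
split; first exact: coef_bound_lim ebound ecvg.
move=> u l ut cl.
apply: (@pseries_tannery _ _ _ _ _ _ _ _ _ (fun n => (p n).[w + u]) _ t0 ebound ecvg ut).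
  move=> n; apply: cvg_near_cst; exists n => // m /= nm.
  rewrite eE horner_poly /series /= (big_cat_nat (n := n))//= [X in _ + X]big_nat_cond.
  rewrite [X in _ + X]big1 ?addr0 ?big_mkord// => i /andP[/andP[ni _] _].
  by rewrite e_big// mul0r.
by apply: cvg_trans cl; apply: near_eq_cvg; apply: nearW => n; rewrite horner_poly_coef.
Qed.

Definition has_pseries f z rho M := exists2 c, coef_bound c rho M &
  forall u, nc u < rho -> pseries c u @ \oo --> f (z + u).

Lemma has_pseries_sub f z rho s M : 0 <= s <= rho ->
  has_pseries f z rho M -> has_pseries f z s M.
Proof.
move=> sr [c cM cf]; exists c; first exact: coef_bound_sub cM.
by move=> u us; apply: cf; case/andP: sr => _; exact: lt_le_trans.
Qed.

(** Restores the constant to a bound of f after an operation, such as recentering, that has worsened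
    it. *)
Lemma has_pseries_cauchy f z rho M' M : 0 < rho -> has_pseries f z rho M' ->
  (forall u, nc u < rho -> nc (f (z + u)) <= M) -> has_pseries f z rho M.
Proof. by move=> rho0 [c cM cf] fM; exists c => //; exact: pseries_cauchy cM cf fM. Qed.

Lemma has_pseries_recenter f z rho M w s : has_pseries f z rho M ->
  nc (w - z) < s < rho ->
  has_pseries f w (s - nc (w - z)) (M / (1 - s / rho)).
Proof.
move=> [c cM cf] ws; have [dM dc] := pseries_recenter cM ws.
exists (recenter c (w - z)) => // u us; apply: (dc _ _ us).
rewrite (_ : w + u = z + (w - z + u)); last by rewrite addrA subrKC.
apply: cf; rewrite (le_lt_trans (normcD_le _ _))//.
by case/andP: ws => _; apply: lt_trans; rewrite addrC -ltrBrDr.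
Qed.

Lemma recenter_unique f c d z w rho delta M M' : 0 < rho -> 0 < delta ->
  coef_bound c rho M -> (forall u, nc u < rho -> pseries c u @ \oo --> f (z + u)) ->
  nc w < rho -> coef_bound d delta M' ->
  (forall u, nc u < delta -> pseries d u @ \oo --> f (z + w + u)) ->
  recenter c w =1 d.
Proof.
move=> rho0 d0 cM cf wr dM df.
pose s := (nc w + rho) / 2; have ws : nc w < s < rho by rewrite /s; lra.
have [rM rf] := pseries_recenter cM ws.
pose t := Num.min delta (s - nc w).
have t0 : 0 < t by rewrite lt_min d0 subr_gt0; case/andP: ws.
apply: (@pseries_unique _ _ _ t (M / (1 - s / rho)) M' (fun u => f (z + w + u)) t0).
- by apply: coef_bound_sub rM; rewrite ltW//= ge_min lexx orbT.
- by apply: coef_bound_sub dM; rewrite ltW//= ge_min lexx.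
- move=> u; rewrite lt_min => /andP[ud us]; apply: (rf _ _ us); rewrite -addrA; apply: cf.
  rewrite (le_lt_trans (normcD_le _ _))//.
  by case/andP: ws => _; apply: lt_trans; rewrite addrC -ltrBrDr.
- by move=> u; rewrite lt_min => /andP[ud us]; exact: df.
Qed.

(* The m-th Taylor coefficient of f at z + w is the power series
   sum_i c_(m+i) 'C(m+i, m) w^i, and it is at most M / delta^m, so Cauchy's
   estimate gives |c_k| 'C(k, m) rho^(k-m) delta^m <= M; summing over m (with
   delta / 2 in place of delta) bounds |c_k| (rho + delta/2)^k by 2 M. *)
Lemma coef_bound_extend f c rho delta z M M' : 0 < rho -> 0 < delta ->
  coef_bound c rho M' ->
  (forall u, nc u < rho -> pseries c u @ \oo --> f (z + u)) ->
  (forall w, nc w < rho -> has_pseries f (z + w) delta M) ->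
  coef_bound c (rho + delta / 2) (2 * M).
Proof.
move=> rho0 d0 cM' cf fd.
have M0 : 0 <= M.
  have [|d dM _] := fd 0; first by rewrite Normc.normc0.
  exact: coef_bound_ge0 dM.
have recM w m : nc w < rho -> nc (recenter c w m) * delta ^+ m <= M.
  move=> wr; have [d dM df] := fd w wr.
  by rewrite (recenter_unique rho0 d0 cM' cf wr dM df).
have binM m i : nc (c (m + i)%N *+ 'C(m + i, m)) * rho ^+ i <= M / delta ^+ m.
  apply: exp_le_lim => // s /andP[s0 sr].
  have s0r : 0 < s < rho by rewrite s0.
  (* Cauchy's estimate is applied to the m-th Taylor coefficient as a function of the center w. *)
  apply: (pseries_cauchy s0 (binomial_coef_bound m s0r cM') (f := fun w => recenter c w m)).
    by move=> w ws; apply: recenter_cvg cM' _ => //; exact: lt_trans sr.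
  move=> w ws; rewrite ler_pdivlMr ?exprn_gt0//; apply: recM; exact: lt_trans sr.
move=> k; rewrite exprDn mulr_sumr.
apply: (@le_trans _ _ (\sum_(i < k.+1) M * (1 / 2) ^+ i)).
  apply: ler_sum => i _; have ik : (i <= k)%N by rewrite -ltnS.
  have := binM i (k - i)%N; rewrite subnKC//.
  rewrite ler_pdivlMr ?exprn_gt0// => h.
  rewrite exprMn.
  have h2 : 0 <= (1 / 2 : R) ^+ i by rewrite exprn_ge0// divr_ge0.
  have := ler_wpM2r h2 h; apply: le_trans.
  have -> : nc (c k *+ 'C(k, i)) = nc (c k) * 'C(k, i)%:R.
    by rewrite -[c k *+ _]mulr_natr Normc.normcM normc_nat.
  rewrite -[in leLHS]mulr_natr div1r le_eqVlt.
  by apply/orP; left; apply/eqP; ring.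
rewrite -mulr_sumr mulrC ler_wpM2r//.
have := subrX1 (1 / 2 : R) k.+1.
set S := \sum_(i < k.+1) _ => h.
have : 0 <= (1 / 2 : R) ^+ k.+1 by rewrite exprn_ge0// divr_ge0.
lra.
Qed.

(** [coef_bound_extend] makes the series converge on the larger disk; its sum is identified with f
    by recentering at a point of the old disk whose local series reaches u. Cauchy's estimate brings
    2 M back to M, so the step can be iterated. *)
Lemma has_pseries_extend f z r rho delta M : 0 < rho <= r -> 0 < delta ->
  (forall u, nc u < r -> nc (f (z + u)) <= M) ->
  (forall w, nc w < r -> has_pseries f (z + w) delta M) ->
  has_pseries f z rho M -> has_pseries f z (Num.min (rho + delta / 2) r) M.
Proof.
move=> /andP[rho0 rr] d0 fM fd [c cM cf].
have fd' w : nc w < rho -> has_pseries f (z + w) delta M.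
  by move=> wr; apply: fd; exact: lt_le_trans rr.
have cM2 := coef_bound_extend rho0 d0 cM cf fd'.
set rho' := rho + delta / 2 in cM2 *.
have rr' : rho < rho' by rewrite /rho'; lra.
have rho'0 : 0 < rho' by exact: lt_trans rr'.
have r'0 : 0 < Num.min rho' r by rewrite lt_min rho'0; exact: lt_le_trans rr.
have key u : nc u < Num.min rho' r -> pseries c u @ \oo --> f (z + u).
  rewrite lt_min => /andP[ur' ur].
  (* Shrinking u by rho / rho' lands in the old disk and moves it by less than rho' - rho = delta /
     2. *)
  pose lam := rho / rho'; pose w := lam%:C * u.
  have lam0 : 0 < lam by rewrite divr_gt0.
  have nw : nc w = lam * nc u by rewrite Normc.normcM normc_real gtr0_norm.
  have wr : nc w < rho by rewrite nw -ltr_pdivlMl// /lam invf_div divfK ?gt_eqF.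
  have lam1 : lam < 1 by rewrite ltr_pdivrMr ?mul1r.
  have nuw : nc (u - w) = (1 - lam) * nc u.
    rewrite -[X in X - _]mul1r -mulrBl Normc.normcM -(rmorph1 (real_complex R)) -rmorphB.
    by rewrite normc_real ger0_norm// subr_ge0 ltW.
  have uwd : nc (u - w) < delta.
    have : (1 - lam) * nc u < (1 - lam) * rho' by rewrite ltr_pM2l ?subr_gt0.
    rewrite -nuw mulrBl mul1r divfK ?gt_eqF// => /lt_trans; apply.
    rewrite /rho'; lra.
  pose s := (nc u + rho') / 2.
  have us : nc u < s by rewrite /s; lra.
  have ws : nc w < s < rho'.
    rewrite nw; apply/andP; split; last by rewrite /s; lra.
    by apply: le_lt_trans us; rewrite ler_piMl ?normc_ge0// ltW.
  have [_ rf] := pseries_recenter cM2 ws.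
  have [l cl] := pseries_cvg rho'0 cM2 ur'.
  have uws : nc (u - w) < s - nc w by rewrite nuw nw; lra.
  have rl : pseries (recenter c w) (u - w) @ \oo --> l.
    by apply: (rf _ _ uws); rewrite addrC subrK.
  have [d dM df] := fd' w wr.
  have rd := recenter_unique rho0 d0 cM cf wr dM df.
  have dl : pseries d (u - w) @ \oo --> f (z + u).
    by have := df _ uwd; rewrite -addrA [w + _]addrC subrK.
  rewrite (funext rd) in rl.
  by rewrite (cvg_seq_unique dl rl); exact: cl.
exists c => //; apply: (pseries_cauchy r'0 _ key (M' := 2 * M)).
  by apply: coef_bound_sub cM2; rewrite ltW//= ge_min lexx.
by move=> u; rewrite lt_min => /andP[_]; exact: fM.
Qed.

(** Neither delta nor M changes along the extensions, so the radius grows by delta / 2 each time and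
    reaches r after finitely many steps. *)
Lemma has_pseries_disk f z r delta M : 0 < r -> 0 < delta ->
  (forall u, nc u < r -> nc (f (z + u)) <= M) ->
  (forall w, nc w < r -> has_pseries f (z + w) delta M) ->
  has_pseries f z r M.
Proof.
move=> r0 d0 fM fd.
have step n : has_pseries f z (Num.min (delta / 2 *+ n.+1) r) M.
  elim: n => [|n IH].
    apply: (@has_pseries_sub _ _ delta).
      rewrite le_min ltW//= ?mulr1n ?divr_gt0//= ltW//= ge_min; apply/orP; left; lra.
    by have := fd 0; rewrite Normc.normc0 addr0; apply.
  have m0 : 0 < delta / 2 *+ n.+1 by rewrite pmulrn_lgt0// divr_gt0.
  have := @has_pseries_extend f z r (Num.min (delta / 2 *+ n.+1) r) delta M.
  rewrite lt_min m0 r0 ge_min lexx orbT => /(_ isT d0 fM fd IH).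
  apply: has_pseries_sub; rewrite le_min.
  have m2 : 0 <= delta / 2 *+ n.+2 by rewrite mulrn_wge0// divr_ge0// ltW.
  rewrite m2 (ltW r0)/= mulrSr !minEle; move: (delta / 2 *+ n.+1) => a.
  by case: (leP (a + _) r) => ?; case: (leP a r) => ?; case: (leP (_ + _) r) => ?; lra.
have := truncnS_gt (r / (delta / 2)); rewrite ltr_pdivrMr ?divr_gt0// => rn.
have := step (Num.truncn (r / (delta / 2))); rewrite min_r//.
by rewrite -mulr_natl ltW.
Qed.

End Recentering.

(** * Montel's theorem *)

Section Montel.
Variable R : realType.
Local Notation C := R[i].
Local Notation nc := (@Normc.normc R).
Local Notation pseries c u := (series (fun k => c k * u ^+ k)).
Implicit Types (c : nat -> C) (u v w z l : C) (rho s t M r delta : R) (f : C -> C).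

(** From N on, partial sums are within 1 of the limit, so terms are at most 2; the sum in the
    constant covers the first N terms. *)
Lemma pseries_cvg_coef_bound c l t : 0 <= t -> pseries c t%:C @ \oo --> l ->
  exists M, coef_bound c t M.
Proof.
move=> t0 /cvg_normcP/(_ 1 ltr01)[N _ NP].
exists (2 + \sum_(i < N) nc (c i) * t ^+ i) => k.
have n0 i : 0 <= nc (c i) * t ^+ i by rewrite mulr_ge0 ?normc_ge0// exprn_ge0.
have [kN|Nk] := ltnP k N.
  rewrite (bigD1 (Ordinal kN))//= addrCA lerDl addr_ge0// sumr_ge0// => i _; exact: n0.
rewrite -[X in X <= _]addr0 lerD//; last by rewrite sumr_ge0// => i _; exact: n0.
have h1 := NP k Nk; have h2 := NP k.+1 (leqW Nk).
have -> : nc (c k) * t ^+ k = nc (c k * t%:C ^+ k).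
  by rewrite Normc.normcM normcX normc_real ger0_norm.
have := normc_tri (pseries c t%:C k.+1) l (pseries c t%:C k).
rewrite {1}[pseries c t%:C k.+1]/series /= big_nat_recr//= -/(series _ _) addrAC subrr add0r.
move/le_trans; apply; rewrite normc_distC; apply: ltW.
by have -> : (2 : R) = 1 + 1 by []; rewrite ltrD.
Qed.

Lemma analytic_at_has_pseries f z : analytic_at f z ->
  exists t, 0 < t /\ exists M, has_pseries f z t M.
Proof.
move=> [c /nbhs_normcP[e e0 cf]].
have e2 : 0 < e / 2 by rewrite divr_gt0.
have cf' u : nc u < e -> pseries c u @ \oo --> f (z + u).
  by move=> ue; have := cf (z + u); rewrite addrC addKr; exact.
have e2e : nc (e / 2)%:C < e by rewrite normc_real ger0_norm ?ltW//; lra.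
have [M cM] := pseries_cvg_coef_bound (ltW e2) (cf' _ e2e).
exists (e / 2); split => //; exists M, c => // u ue; apply: cf'.
by apply: lt_trans ue _; lra.
Qed.

Lemma has_pseries_analytic_at f z t M : 0 < t -> has_pseries f z t M -> analytic_at f z.
Proof.
move=> t0 [c cM cf]; exists c; apply/nbhs_normcP; exists t => // w wt.
by have := cf _ wt; rewrite subrKC.
Qed.

(** A uniform local radius comes from compactness: points w_n where the radius 1 / (n + 1) fails
    would converge along an ultrafilter to some l, and the series at z + l, recentered at z + w_n,
    has a fixed radius. *)
Lemma bounded_analytic_has_pseries f z r M :
  (forall w, nc w < 1 -> analytic_at f w) ->
  (forall w, nc w < 1 -> nc (f w) <= M) ->
  0 < r -> nc z + r < 1 -> has_pseries f z r M.
Proof.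
move=> fa fM r0 zr.
have in_disk w : nc w <= r -> nc (z + w) < 1.
  by move=> wr; apply: le_lt_trans (normcD_le _ _) _; lra.
suff [delta d0 fd] : exists2 delta, 0 < delta &
    forall w, nc w < r -> has_pseries f (z + w) delta M.
  by apply: has_pseries_disk d0 _ fd => // u ur; apply/fM/in_disk/ltW.
apply: contrapT => nd.
have /choice[w wP] : forall n : nat, exists w,
    nc w < r /\ ~ has_pseries f (z + w) (n.+1%:R)^-1 M.
  move=> n; apply: contrapT => nw; apply: nd; exists (n.+1%:R)^-1.
    by rewrite invr_gt0.
  by move=> w wr; apply: contrapT => h; apply: nw; exists w.
have [G [UG ooG]] := ultraFilterLemma (F := \oo : set_system nat) _.
have [|l wl lr] := @ultra_bounded_cvg R _ G UG w r.
  by apply: ooG; exists 0%N => // n _ /=; apply: ltW; have [] := wP n.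
have l1 := in_disk _ lr.
have [t [t0 [M' ft]]] := analytic_at_has_pseries (fa _ l1).
(* The cap keeps the disk around z + l inside the unit disk, where f is bounded by M. *)
pose t' := Num.min t (1 - nc (z + l)).
have t'0 : 0 < t' by rewrite lt_min t0 subr_gt0.
have {}ft : has_pseries f (z + l) t' M'.
  by apply: has_pseries_sub ft; rewrite ltW//= ge_min lexx.
have t'1 : t' <= 1 - nc (z + l) by rewrite ge_min lexx orbT.
clearbody t'.
have t2 : 0 < t' / 2 by rewrite divr_gt0.
have : \forall n \near \oo, (n.+1%:R)^-1 < t' / 2.
  have := @cvg_harmonic R => /cvgrPdist_lt/(_ _ t2); apply: filterS => n.
  by rewrite sub0r normrN ger0_norm//= invr_ge0.
move=> /ooG hn; have /cvg_normcP/(_ _ t2) wn := wl.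
have [n [/= ns wt]] := filter_ex (filterI hn wn).
have [_] := wP n; apply.
apply: (@has_pseries_sub _ _ _ (t' / 2)); first by rewrite invr_ge0 ler0n/= ltW.
have E : z + w n - (z + l) = w n - l by rewrite opprD addrACA subrr add0r.
(* The intermediate radius is chosen so that recentering leaves exactly t' / 2. *)
have ss : nc (z + w n - (z + l)) < nc (w n - l) + t' / 2 < t'.
  by rewrite E normc_distC; lra.
have := has_pseries_recenter ft ss; rewrite E [X in X - _]addrC addrK => h.
apply: has_pseries_cauchy h _ => // u ut; apply: fM.
have -> : z + w n + u = (z + l) + (w n - l) + u by rewrite -E addrC subrKC addrC.
apply: le_lt_trans (normcD_le _ _) _.
have := normcD_le (z + l) (w n - l); rewrite normc_distC in wt; lra.
Qed.

(** Around z all [h i] have power series on one disk with the same constant M. Their coefficients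
    converge along F, and Tannery's theorem identifies the sum with the pointwise limit. The value 0
    off the disk matches the encoding of [hinf]. *)
Lemma montel T (F : set_system T) {UF : UltraFilter F} (h : T -> C -> C) M :
  (forall i w, nc w < 1 -> analytic_at (h i) w) ->
  (forall i w, nc w < 1 -> nc (h i w) <= M) ->
  exists g : C -> C, [/\ forall w, nc w < 1 -> analytic_at g w,
    forall w, nc w < 1 -> nc (g w) <= M,
    forall w, nc w < 1 -> h i w @[i --> F] --> g w &
    forall w, ~ nc w < 1 -> g w = 0].
Proof.
move=> ha hM.
have /choice[g gP'] : forall w, exists l, (nc w < 1 ->
    h i w @[i --> F] --> l /\ nc l <= M) /\ (~ nc w < 1 -> l = 0).
  move=> w; have [w1|w1] := ltP (nc w) 1; last by exists 0.
  have [|l hl lM] := @ultra_bounded_cvg R _ F UF (h^~ w) M.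
    by apply: (@filterE _ F) => i; exact: hM.
  by exists l; split=> [_|/(_ isT)].
have gP w := (gP' w).1.
exists g; split=> [|w /gP[]//|w /gP[]//|w]; last exact: (gP' w).2.
move=> z z1; pose r := (1 - nc z) / 2.
have r0 : 0 < r by rewrite /r; lra.
have zr : nc z + r < 1 by rewrite /r; lra.
have /choice[c cP] : forall i, exists c, coef_bound c r M /\
    forall u, nc u < r -> pseries c u @ \oo --> h i (z + u).
  by move=> i; have [c cM cf] := bounded_analytic_has_pseries (ha i) (hM i) r0 zr; exists c.
have /choice[d cd] : forall k, exists l, c i k @[i --> F] --> l.
  move=> k; have [|l hl lM] := @ultra_bounded_cvg R _ F UF (c^~ k) (M / r ^+ k).
    apply: (@filterE _ F) => i; rewrite ler_pdivlMr ?exprn_gt0//.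
    exact: (cP i).1.
  by exists l.
apply: (has_pseries_analytic_at (t := r) (M := M)) => //.
exists d; first by apply: coef_bound_lim cd => // i; exact: (cP i).1.
move=> u ur.
apply: (@pseries_tannery _ _ F _ c d r M u (fun i => h i (z + u)) _ r0 _ cd ur).
- by move=> i; exact: (cP i).1.
- by move=> i; exact: (cP i).2.
- apply: (gP (z + u) _).1; apply: le_lt_trans (normcD_le _ _) _; lra.
Qed.

End Montel.

(** * Approximate interpolation *)

Section Interpolation.
Variable R : realType.
Local Notation C := R[i].
Local Notation nc := (@Normc.normc R).
Implicit Types (z : C) (t K W B e d : R) (N : nat).

(** The Euclidean inner product of the plane. *)
Definition rdot (x y : C) : R := complex.Re x * complex.Re y + complex.Im x * complex.Im y.

Lemma sqr_normc x : nc x ^+ 2 = rdot x x.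
Proof. by case: x => a b /=; rewrite sqr_sqrtr ?addr_ge0 ?sqr_ge0. Qed.

Lemma rdot_le x y : rdot x y <= nc x * nc y.
Proof.
have -> : rdot x y = complex.Re (conjc x * y).
  by case: x y => a b [c d]; rewrite /rdot /=; ring.
apply: le_trans (ler_norm _) _; apply: le_trans (Re_le _) _.
by rewrite Normc.normcM; case: (x) => a b /=; rewrite sqrrN.
Qed.

Lemma sqr_normc_sub t (x y : C) :
  nc (x - t%:C * y) ^+ 2 = nc x ^+ 2 - 2 * t * rdot x y + t ^+ 2 * nc y ^+ 2.
Proof.
by rewrite !sqr_normc; case: x y => a b [c d]; rewrite /rdot /=; ring.
Qed.

(* If v nearly minimises the distance to w, moving from v towards v' changes
   the squared distance by -2 t <w - v, v' - v> + O(t^2); so if that distance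
   were positive, w - v would separate w from A. *)
Lemma convex_approx (A : set (nat -> C)) N (w : nat -> C) B :
  A !=set0 ->
  (forall v v' t, A v -> A v' -> 0 <= t <= 1 ->
     A (fun n => v n + t%:C * (v' n - v n))) ->
  (forall v n, A v -> nc (v n) <= B) ->
  (forall (u : nat -> C) e, 0 < e -> exists2 v, A v &
     \sum_(n < N) rdot (u n) (w n) - e <= \sum_(n < N) rdot (u n) (v n)) ->
  forall e, 0 < e -> exists2 v, A v & \sum_(n < N) nc (v n - w n) ^+ 2 < e.
Proof.
move=> [v0 Av0] cvx AB sup e e0.
pose J (v : nat -> C) : R := \sum_(n < N) nc (w n - v n) ^+ 2.
have J0 v : 0 <= J v by apply: sumr_ge0 => n _; rewrite exprn_ge0 ?normc_ge0.
suff [v Av Jv] : exists2 v, A v & J v < e.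
  by exists v => //; rewrite (le_lt_trans _ Jv)// ler_sum// => n _; rewrite normc_distC.
apply: contrapT => noJ.
pose S : set R := [set J v | v in A].
have S0 : S !=set0 by exists (J v0), v0.
have Slb : has_lbound S by exists 0 => _ [v _ <-].
set d := inf S.
have dJ v : A v -> d <= J v by move=> Av; apply: ge_inf => //; exists v.
have d0 : 0 < d.
  apply: lt_le_trans e0 _; apply: lb_le_inf => // _ [v Av <-].
  by rewrite leNgt; apply/negP => Jv; apply: noJ; exists v.
pose D : R := N%:R * (2 * B) ^+ 2 + d.
have B0 : 0 <= N%:R * (2 * B) ^+ 2 by rewrite mulr_ge0// exprn_even_ge0.
have D0 : 0 < D by rewrite /D; lra.
(* With t D = d / 2 the quadratic term is at most t d / 2, the linear term gains at least t d, and v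
   exceeds the infimum by less than t d / 4: the new value falls below d. *)
pose t : R := d / (2 * D).
have t0 : 0 < t by rewrite divr_gt0// mulr_gt0.
have t1 : t <= 1 by rewrite ler_pdivrMr ?mul1r ?mulr_gt0// /D; lra.
have td0 : 0 < t * d / 4 by rewrite divr_gt0// mulr_gt0.
have [_ [v Av <-] Jv] := inf_adherent td0 (conj S0 Slb).
rewrite -/d in Jv.
pose u (n : nat) : C := w n - v n.
have d2 : 0 < d / 2 by rewrite divr_gt0.
have [v' Av' sv'] := sup u _ d2.
have t01 : 0 <= t <= 1 by rewrite ltW.
have := dJ _ (cvx v v' t Av Av' t01).
have -> : J (fun n => v n + t%:C * (v' n - v n)) =
    J v - 2 * t * (\sum_(n < N) rdot (u n) (v' n - v n)) +
    t ^+ 2 * \sum_(n < N) nc (v' n - v n) ^+ 2.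
  rewrite !mulr_sumr -sumrB -big_split /=; apply: eq_bigr => n _.
  by rewrite opprD addrA sqr_normc_sub.
have rB (x y z : C) : rdot x (y - z) = rdot x y - rdot x z.
  by case: x y z => a b [a' b'] [a2 b2]; rewrite /rdot /=; ring.
have -> : \sum_(n < N) rdot (u n) (v' n - v n) =
    (\sum_(n < N) rdot (u n) (v' n) - \sum_(n < N) rdot (u n) (w n)) + J v.
  rewrite -sumrB -big_split /=; apply: eq_bigr => n _.
  by rewrite sqr_normc -/(u n) [rdot _ (_ - _)]rB {4}/u rB; ring.
have : \sum_(n < N) nc (v' n - v n) ^+ 2 <= N%:R * (2 * B) ^+ 2.
  rewrite mulr_natl -[in X in _ <= X](card_ord N) -sumr_const; apply: ler_sum => n _.
  rewrite lerXn2r ?nnegrE ?normc_ge0//.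
    by rewrite mulr_ge0// (le_trans _ (AB v n Av))// normc_ge0.
  apply: le_trans (normcD_le _ _) _; rewrite normc_opp.
  by have := AB v n Av; have := AB v' n Av'; lra.
have Jd := dJ v Av.
set X : R := \sum_(n < N) nc (v' n - v n) ^+ 2.
set P : R := \sum_(n < N) rdot (u n) (v' n) in sv' *.
set Q : R := \sum_(n < N) rdot (u n) (w n) in sv' *.
move=> XD.
have tD : t * D = d / 2 by rewrite /t; field; rewrite gt_eqF.
have h1 : t ^+ 2 * X <= t * (d / 2).
  rewrite -tD expr2 -mulrA !(ler_wpM2l (ltW t0))// /D.
  by rewrite (le_trans XD)// lerDl (ltW d0).
have h2 : t * (d / 2) <= t * (P - Q + J v) by rewrite (ler_wpM2l (ltW t0))//; lra.
nra.
Qed.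

Section Hinf.
Variable E : submodClosed (hinf R).

(** Duality in finite dimension: by [lower] applied to the conjugate of u, the values at the b_n of
    the ball of radius K W reach at least W times the sum of the |u_n|, up to d, in the direction u.
    So no u separates w from them. *)
Lemma finite_interpolation (b w : nat -> C) N K W e : 0 <= K -> 0 <= W ->
  (forall (c : nat -> C) d, 0 < d -> exists2 h : space_of E, hinf_norm h <= 1 &
     \sum_(n < N) nc (c n) - d <= K * nc (\sum_(n < N) c n * h (b n))) ->
  (forall n, nc (w n) <= W) -> 0 < e ->
  exists2 h : space_of E, hinf_norm h <= K * W &
    forall n, (n < N)%N -> nc (h (b n) - w n) < e.
Proof.
move=> K0 W0 lower wW e0; have KW0 : 0 <= K * W by rewrite mulr_ge0.
pose A : set (nat -> C) := [set (fun n => h (b n)) | h in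
  [set h : space_of E | hinf_norm h <= K * W]].
have [] := @convex_approx A N w (K * W) _ _ _ _ (e ^+ 2).
- exists (fun n => (0 : space_of E) (b n)), 0 => //.
  by apply: hinf_norm_le => z; rewrite [X in nc X](_ : _ = 0)// Normc.normc0.
- move=> _ _ t [h hW <-] [h' h'W <-] /andP[t0 t1].
  exists (h + t%:C *: (h' - h)) => //=.
  apply: hinf_norm_le => z.
  rewrite [X in nc X](_ : _ = h z + t%:C * (h' z - h z))//.
  have -> : h z + t%:C * (h' z - h z) = (1 - t)%:C * h z + t%:C * h' z.
    by rewrite rmorphB rmorph1; ring.
  apply: le_trans (normcD_le _ _) _; rewrite !Normc.normcM !normc_real.
  rewrite (ger0_norm t0) ger0_norm ?subr_ge0//.
  have h1 := le_trans (hinf_norm_ub h z) hW.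
  have h2 := le_trans (hinf_norm_ub h' z) h'W.
  have h3 : (1 - t) * nc (h z) <= (1 - t) * (K * W) by rewrite ler_wpM2l// subr_ge0.
  have h4 : t * nc (h' z) <= t * (K * W) by rewrite ler_wpM2l.
  lra.
- by move=> _ n [h hW <-]; exact: le_trans (hinf_norm_ub h _) hW.
- move=> u d d0; pose d' : R := d / (W + 1).
  (* Dividing by W + 1 gives W d' <= d, also when W = 0. *)
  have d'0 : 0 < d' by rewrite divr_gt0// ltr_wpDl.
  have [h h1 hu] := lower (fun n => conjc (u n)) d' d'0.
  set S := \sum_(n < N) _ * _ in hu.
  (* A factor of modulus 1 that rotates S onto the nonnegative real axis. *)
  pose al : C := if nc S == 0 then 1 else conjc S / (nc S)%:C.
  have nconj z : nc (conjc z) = nc z by case: z => x y /=; rewrite sqrrN.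
  have al1 : nc al <= 1.
    rewrite /al; case: eqP => [_|/eqP S0]; first by rewrite Normc.normc1.
    rewrite Normc.normcM Normc.normcV nconj normc_real ger0_norm ?normc_ge0//.
    by rewrite divff.
  have alS : al * S = (nc S)%:C.
    rewrite /al; case: eqP => [S0|/eqP S0]; first by rewrite S0 (Normc.eq0_normc S0) mulr0.
    apply: (mulIf (x := (nc S)%:C)); first by rewrite fmorph_eq0.
    rewrite mulrAC divfK ?fmorph_eq0// -rmorphM -expr2 sqr_normc.
    by case: (S) => x y; rewrite /rdot /=; apply/eqP; rewrite eq_complex /=; apply/andP; split; apply/eqP; ring.
  pose g : space_of E := (K * W)%:C * al *: h.
  exists (fun n => g (b n)).
    exists g => //=.
    rewrite (le_trans (hinf_normZ _ _))// Normc.normcM normc_real ger0_norm//.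
    rewrite -mulrA ler_piMr//; apply: le_trans al1.
    by rewrite ler_piMr// normc_ge0.
  have rdotE (x y : nat -> C) : \sum_(n < N) rdot (x n) (y n) =
      complex.Re (\sum_(n < N) conjc (x n) * y n).
    apply: (big_ind2 (fun a z => a = complex.Re z)) => // [_ [? ?] _ [? ?] -> ->|n _] //.
    by case: (x n) (y n) => a1 b1 [a2 b2]; rewrite /rdot /=; ring.
  have -> : \sum_(n < N) rdot (u n) (g (b n)) = K * W * nc S.
    rewrite (rdotE u (fun n => g (b n))).
    suff -> : \sum_(n < N) conjc (u n) * g (b n) = (K * W)%:C * (al * S).
      by rewrite alS -rmorphM.
    rewrite /S !mulr_sumr; apply: eq_bigr => n _.
    by rewrite [g (b n)](_ : _ = (K * W)%:C * al * h (b n))//; ring.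
  have : \sum_(n < N) rdot (u n) (w n) <= W * \sum_(n < N) nc (u n).
    rewrite mulr_sumr; apply: ler_sum => n _; apply: le_trans (rdot_le _ _) _.
    by rewrite mulrC ler_wpM2r// normc_ge0.
  have hu' : \sum_(n < N) nc (u n) - d' <= K * nc S.
    by rewrite (le_trans _ hu)// lerD2r; apply: ler_sum => n _; rewrite nconj.
  have := ler_wpM2l W0 hu'.
  have : W * d' <= d by rewrite /d' mulrA ler_pdivrMr ?ltr_wpDl//; nra.
  nra.
- by rewrite exprn_gt0.
move=> _ [h hW <-] hs; exists h => // n nN.
rewrite -(@ltr_pXn2r _ 2) ?nnegrE ?normc_ge0 ?(ltW e0)//.
apply: le_lt_trans hs; rewrite (bigD1 (Ordinal nN))//= lerDl.
by apply: sumr_ge0 => i _; rewrite exprn_ge0// normc_ge0.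
Qed.

(** The N-th approximant is within 1 / (N + 1) of the data at the first N points and has norm at
    most K W; its limit along an ultrafilter interpolates exactly. The slack [d] allows for a
    supremum that is only approached. *)
Lemma interpolating_of_lower_bound (b : nat -> C) K : 0 <= K ->
  (forall n, unit_disk (b n)) ->
  (forall N (c : nat -> C) d, 0 < d -> exists2 h : space_of E, hinf_norm h <= 1 &
     \sum_(n < N) nc (c n) - d <= K * nc (\sum_(n < N) c n * h (b n))) ->
  interpolating b.
Proof.
move=> K0 bD lower; split=> // w [W wW].
have {}wW n : nc (w n) <= W by rewrite -normc_le.
have W0 : 0 <= W by apply: le_trans (wW 0%N); exact: normc_ge0.
have /choice[h hP] : forall N : nat, exists h : space_of E,
    hinf_norm h <= K * W /\ forall n, (n < N)%N -> nc (h (b n) - w n) < N.+1%:R^-1.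
  move=> N; have N0 : 0 < N.+1%:R^-1 :> R by rewrite invr_gt0.
  by have [h hW hw] := finite_interpolation K0 W0 (lower N) wW N0; exists h.
have [G [UG ooG]] := ultraFilterLemma (F := \oo : set_system nat) _.
have [||g [ga gM hg g0]] := @montel R _ G UG (fun N => h N : C -> C) (K * W).
- move=> N z z1; case: (h N) => -[f fP] fE /=.
  by have /asboolP[fa _ _] := fP; apply: fa; rewrite unit_diskE.
- by move=> N z _; exact: le_trans (hinf_norm_ub _ _) (hP N).1.
have gP : g \in @hinf_pred R.
  apply/asboolP; split.
  - by move=> z; rewrite unit_diskE; exact: ga.
  - by exists (K * W) => z; rewrite unit_diskE normc_le; exact: gM.
  - by move=> z; rewrite unit_diskE; exact: g0.
exists (Hinf gP) => n /=.
apply/eqP; rewrite -subr_eq0; apply/eqP/Normc.eq0_normc/eqP.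
rewrite eq_le normc_ge0 andbT; apply/ler_addgt0Pr => e e0; rewrite add0r.
have bn : nc (b n) < 1 by rewrite -unit_diskE.
apply: near_le_lim (hg _ bn) _; apply: ooG.
have : \forall N \near \oo, (N.+1%:R)^-1 < e.
  have := @cvg_harmonic R => /cvgrPdist_lt/(_ _ e0); apply: filterS => N.
  by rewrite sub0r normrN ger0_norm//= invr_ge0.
move=> hn; near=> N; apply: ltW; apply: (@lt_trans _ _ N.+1%:R^-1).
  by apply: (hP N).2; near: N; exact: nbhs_infty_gt.
by near: N.
Unshelve. all: by end_near. Qed.

End Hinf.

End Interpolation.

(** * Perturbation of l^1-bases *)

Section BoundedLinear.
Variable R : realType.
Local Notation C := R[i].

Lemma continuous_linear_norm_le (V W : normedModType C) (f : {linear V -> W}) :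
  continuous f -> exists2 K : R, 0 < K & forall x, `|f x| <= K%:C * `|x|.
Proof.
move=> /linear_bounded_continuous/linear_boundedP/pinfty_ex_gt0[_ /gt0_complexE[K K0 ->]].
by exists K.
Qed.

Lemma linear_norm_le_continuous (V W : normedModType C) (f : {linear V -> W}) (K : R) :
  (forall x, `|f x| <= K%:C * `|x|) -> continuous f.
Proof.
move=> fK; apply/linear_bounded_continuous/linear_boundedP.
exists (`|K|%:C); split.
  by rewrite complex_real.
move=> r Kr x; apply: le_trans (fK x) _; rewrite ler_wpM2r//.
by apply: le_trans (ltW Kr); rewrite lecR ler_norm.
Qed.

End BoundedLinear.

(** * The space l^1: completeness, operators given on unit vectors, Neumann series *)

Section Ell1.
Variable R : realType.
Local Notation C := R[i].
Local Notation nc := (@Normc.normc R).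
Local Notation en := (@ell1_norm R).
Local Notation ell1 := (ell1 R).
Implicit Types (x y z : ell1) (a : C).

Lemma ell1_norm_partial x N : \sum_(0 <= k < N) nc (x k) <= en x.
Proof.
have nd : nondecreasing_seq (series (fun n => nc (x n))).
  by apply: nondecreasing_series => k _ _; exact: normc_ge0.
exact: (nondecreasing_cvgn_le nd (@ell1_cvg R x)).
Qed.

Lemma ell1_norm_le x (M : R) :
  (forall N, \sum_(0 <= k < N) nc (x k) <= M) -> en x <= M.
Proof.
by move=> xM; apply: limr_le; [exact: ell1_cvg|apply: nearW => N; exact: xM].
Qed.

Lemma ell1_coef_le x k : nc (x k) <= en x.
Proof.
apply: le_trans (ell1_norm_partial x k.+1).
by rewrite big_nat_recr//= lerDr sumr_ge0// => i _; exact: normc_ge0.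
Qed.

Lemma ell1_predP (x : nat -> C) (M : R) :
  (forall N, \sum_(0 <= k < N) nc (x k) <= M) -> x \in @ell1_pred R.
Proof.
move=> xM; apply/asboolP; apply: nondecreasing_is_cvgn.
  by apply: nondecreasing_series => k _ _; exact: normc_ge0.
by exists M => _ [N _ <-]; exact: xM.
Qed.

Lemma ell1_tri x y : en (x + y) <= en x + en y.
Proof. by have := ell1_normD x y; rewrite -rmorphD lecR. Qed.

Lemma ell1_scale a x : en (a *: x) = nc a * en x.
Proof. by apply/complexI; rewrite ell1_normZ Defs.normcE rmorphM. Qed.

Lemma ell1_opp x : en (- x) = en x.
Proof. by rewrite -scaleN1r ell1_scale normc_opp Normc.normc1 mul1r. Qed.

Lemma ell1_sub x y : en (x - y) <= en x + en y.
Proof. by rewrite -(ell1_opp y) ell1_tri. Qed.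

Lemma ell1_norm_ge0 x : 0 <= en x.
Proof. exact: le_trans (normc_ge0 _) (ell1_coef_le x 0). Qed.

Lemma ell1_eq0 x : en x <= 0 -> x = 0.
Proof.
by move=> x0; apply: ell1_norm0_eq0; congr (_%:C); apply/eqP; rewrite eq_le x0 ell1_norm_ge0.
Qed.

Lemma ell1_norm_sum (I : Type) (r : seq I) (F : I -> ell1) :
  en (\sum_(i <- r) F i) <= \sum_(i <- r) en (F i).
Proof.
elim/big_ind2 : _ => [|x1 x2 y1 y2 h1 h2|//].
  by rewrite -(scale0r (0 : ell1)) ell1_scale Normc.normc0 mul0r.
by rewrite (le_trans (ell1_tri _ _))// lerD.
Qed.

Lemma ell1_unit_norm n : en (ell1_unit R n) = 1.
Proof.
apply/eqP; rewrite eq_le; apply/andP; split; last first.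
  by apply: le_trans (ell1_coef_le _ n); rewrite /= eqxx Normc.normc1.
apply: ell1_norm_le => m.
rewrite (eq_bigr (fun k => (k == n)%:R)); last first.
  by move=> k _ /=; case: eqP => _; rewrite ?Normc.normc1 ?Normc.normc0.
have [nm|mn] := ltnP n m.
  rewrite (bigD1_seq n) ?mem_index_iota ?iota_uniq//= eqxx big1 ?addr0//.
  by move=> k /negPf ->.
rewrite big_nat_cond big1 ?ler01// => k /andP[/andP[_ km] _].
by rewrite (ltn_eqF (leq_trans km mn)).
Qed.

(** Completeness with an explicit rate: coordinates converge along an ultrafilter, and each finite
    sum of moduli keeps the bound [e n] in the limit. *)
Lemma ell1_complete (s : nat -> ell1) (e : nat -> R) :
  (forall n m, (n <= m)%N -> en (s m - s n) <= e n) ->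
  exists x, forall n, en (x - s n) <= e n.
Proof.
move=> se.
have [G [UG ooG]] := ultraFilterLemma (F := \oo : set_system nat) _.
have /choice[l lP] : forall k, exists l : C, s n k @[n --> G] --> l.
  move=> k; have [|l hl _] := @ultra_bounded_cvg R _ G UG (fun n => s n k) (e 0%N + en (s 0%N)).
    apply: ooG; exists 0%N => // n _ /=; apply: le_trans (ell1_coef_le _ _) _.
    rewrite -[X in en X](subrK (s 0%N)) (le_trans (ell1_tri _ _))// lerD2r; exact: se.
  by exists l.
have key n N : \sum_(0 <= k < N) nc (l k - s n k) <= e n.
  have : (fun m => \sum_(0 <= k < N) nc (s m k - s n k)) @ G -->
      \sum_(0 <= k < N) nc (l k - s n k).
    elim: N => [|N IH].
      rewrite big_geq//; apply: cvg_near_cst; apply: ooG; exists 0%N => // m _ /=.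
      by rewrite big_geq.
    rewrite big_nat_recr//= (_ : (fun m => _) = (fun m => \sum_(0 <= k < N) nc (s m k - s n k)
      + nc (s m N - s n N))); last by apply/funext => m; rewrite big_nat_recr.
    apply: cvgD IH _.
    have h : s m N - s n N @[m --> G] --> l N - s n N.
      exact: cvgB (lP N) (cvg_cst _).
    exact: cvg_normc h.
  move=> h; rewrite -(cvg_lim _ h)//; apply: limr_le.
    by apply/cvg_ex; eexists; exact: h.
  apply: ooG; exists n => // m /= nm; apply: le_trans (se n m nm).
  exact: (ell1_norm_partial (s m - s n)).
(* The case n = 0 shows that l - s 0, hence l, is summable. *)
pose y : ell1 := Ell1 (ell1_predP (key 0%N)).
exists (y + s 0%N) => n; apply: ell1_norm_le => N.
rewrite (eq_bigr (fun k => nc (l k - s n k))) ?key// => k _.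
rewrite [X in nc X](_ : _ = l k - s 0%N k + s 0%N k - s n k)//.
by rewrite subrK.
Qed.

Lemma ell1_series_tail x (e : R) : 0 < e ->
  \forall N \near \oo, en x - \sum_(0 <= k < N) nc (x k) < e.
Proof.
move=> e0; have /cvgrPdist_lt/(_ _ e0) := @ell1_cvg R x.
by apply: filterS => N; apply: le_lt_trans; exact: ler_norm.
Qed.

(** B x is the sum of the x_k v_k, known through its distance to the partial sums. Linearity follows
    since these distances tend to 0, and the norm bound is the case of the empty partial sum. *)
Lemma ell1_operator (v : nat -> ell1) (M : R) : (forall n, en (v n) <= M) ->
  exists B : ell1 -> ell1, [/\ linear B, forall x, en (B x) <= M * en x &
    forall n, B (ell1_unit R n) = v n].
Proof.
move=> vM; have M0 : 0 <= M by exact: le_trans (ell1_norm_ge0 _) (vM 0%N).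
pose s x N : ell1 := \sum_(0 <= k < N) x k *: v k.
pose e x N : R := M * (en x - \sum_(0 <= k < N) nc (x k)).
have /choice[B BP] : forall x, exists y, forall n, en (y - s x n) <= e x n.
  move=> x; apply: ell1_complete => n m nm.
  have -> : s x m = s x n + \sum_(n <= k < m) x k *: v k.
    by rewrite /s (big_cat_nat (n := n)).
  rewrite [X in en X]addrAC subrr add0r.
  apply: le_trans (ell1_norm_sum _ _) _.
  apply: (@le_trans _ _ (M * \sum_(n <= k < m) nc (x k))).
    rewrite mulr_sumr; apply: ler_sum => k _.
    by rewrite ell1_scale mulrC ler_wpM2r// normc_ge0.
  rewrite ler_wpM2l// lerBrDl; apply: le_trans (ell1_norm_partial x m).
  by rewrite [leRHS](big_cat_nat (n := n)).
have e_small x d : 0 < d -> \forall N \near \oo, e x N < d.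
  move=> d0; have d0' : 0 < d / (M + 1) by rewrite divr_gt0// ltr_wpDl.
  apply: filterS (ell1_series_tail x d0') => N h.
  have x0 : 0 <= en x - \sum_(0 <= k < N) nc (x k).
    by rewrite subr_ge0 ell1_norm_partial.
  rewrite ltr_pdivlMr ?ltr_wpDl// in h.
  apply: le_lt_trans h; rewrite /e; nra.
exists B; split.
- move=> a x y; apply/eqP; rewrite -subr_eq0; apply/eqP/ell1_eq0.
  apply/ler_addgt0Pr => d d0; rewrite add0r.
  (* Three errors, weighted by 1, |a| and 1, must add up to at most d. *)
  have d1 : 0 < d / (nc a + 2).
    by rewrite divr_gt0// ltr_wpDl ?normc_ge0.
  near \oo => N.
  have h1 : e (a *: x + y) N < d / (nc a + 2) by near: N; exact: e_small.
  have h2 : e x N < d / (nc a + 2) by near: N; exact: e_small.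
  have h3 : e y N < d / (nc a + 2) by near: N; exact: e_small.
  have sE : s (a *: x + y) N = a *: s x N + s y N.
    rewrite /s scaler_sumr -big_split /=; apply: eq_bigr => k _.
    by rewrite scalerA -scalerDl.
  have -> : B (a *: x + y) - (a *: B x + B y) =
     (B (a *: x + y) - s (a *: x + y) N) - (a *: (B x - s x N) + (B y - s y N)).
    by rewrite sE scalerBr addrACA -opprD opprB addrA subrK.
  apply: le_trans (ell1_sub _ _) _.
  have h4 := BP (a *: x + y) N.
  have h5 := le_trans (ell1_tri (a *: (B x - s x N)) (B y - s y N)) (lerD (lexx _) (BP y N)).
  rewrite ell1_scale in h5.
  have h6 : nc a * en (B x - s x N) <= nc a * (d / (nc a + 2)).
    by rewrite ler_wpM2l ?normc_ge0// (le_trans (BP x N))// ltW.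
  have -> : d = (nc a + 2) * (d / (nc a + 2)).
    by rewrite mulrC divfK// gt_eqF// ltr_wpDl ?normc_ge0.
  lra.
- move=> x; have := BP x 0%N; rewrite /s /e !big_geq// !subr0//.
- move=> n; apply/eqP; rewrite -subr_eq0; apply/eqP/ell1_eq0.
  (* From n + 1 on, nothing of the unit vector is left: the tail bound is 0. *)
  have := BP (ell1_unit R n) n.+1.
  have -> : s (ell1_unit R n) n.+1 = v n.
    rewrite /s big_nat_recr//= eqxx scale1r big_nat_cond big1 ?add0r// => k.
    by rewrite andbT => /andP[_ kn]; rewrite (ltn_eqF kn) scale0r.
  move/le_trans; apply; rewrite /e ell1_unit_norm mulr_ge0_le0// subr_le0.
  rewrite big_nat_recr//= eqxx Normc.normc1 lerDr sumr_ge0// => k _.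
  exact: normc_ge0.
Unshelve. all: by end_near. Qed.

(** N x is the sum of the (-B)^i x, of norm at most (1 + 1/2 + 1/4 + ...) |x|. The sums s telescope:
    s + B s is x minus the next term. *)
Lemma ell1_neumann (B : ell1 -> ell1) : linear B ->
  (forall x, en (B x) <= 2^-1 * en x) ->
  exists N : ell1 -> ell1, [/\ linear N, forall x, en (N x) <= 2 * en x,
    forall x, N x + B (N x) = x & forall x, N (x + B x) = x].
Proof.
move=> lB B2.
have B0 : B 0 = 0 by have := lB (-1) 0 0; rewrite scaler0 addr0 scaleN1r addNr.
have BD x y : B (x + y) = B x + B y by have := lB 1 x y; rewrite !scale1r.
have BZ a x : B (a *: x) = a *: B x by have := lB a x 0; rewrite !addr0 B0 addr0.
have BN x : B (- x) = - B x by rewrite -scaleN1r BZ scaleN1r.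
have Binj x : x + B x = 0 -> x = 0.
  move=> xB; apply: ell1_eq0; have := B2 x.
  have -> : B x = - x by apply/eqP; rewrite -addr_eq0 addrC xB.
  by rewrite ell1_opp; lra.
pose P n x := iter n (fun y => - B y) x.
have PB n x : en (P n x) <= 2^-1 ^+ n * en x.
  elim: n => [|n IH]; first by rewrite expr0 mul1r.
  rewrite /P iterS -/(P n x) ell1_opp exprS; have := B2 (P n x); nra.
pose s x n : ell1 := \sum_(0 <= i < n) P i x.
have sB x n : s x n + B (s x n) = x - P n x.
  elim: n => [|n IH]; first by rewrite /s big_geq// B0 addr0 subrr.
  rewrite /s big_nat_recr//= -/(s x n) BD addrACA IH.
  by rewrite addrA subrK opprK.
pose e x n : R := 2 * 2^-1 ^+ n * en x.
have /choice[N NP] : forall x, exists y, forall n, en (y - s x n) <= e x n.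
  move=> x; apply: ell1_complete => n m nm.
  have -> : s x m - s x n = \sum_(n <= i < m) P i x.
    by rewrite /s (big_cat_nat (n := n))//= addrAC subrr add0r.
  apply: le_trans (ell1_norm_sum _ _) _.
  apply: (@le_trans _ _ (e x n - e x m)); last first.
    by rewrite gerBl /e !mulr_ge0 ?ell1_norm_ge0 ?exprn_ge0// invr_ge0.
  rewrite -(subnKC nm); elim: (m - n)%N => [|j IH].
    by rewrite addn0 big_geq// subrr.
  rewrite addnS big_nat_recr ?leq_addr//=.
  have := PB (n + j)%N x; move: IH; rewrite /e exprS; lra.
have e_small x d : 0 < d -> \forall n \near \oo, e x n < d.
  move=> d0; have h : 0 <= 2^-1 :> R by rewrite invr_ge0.
  have : (fun n => 2 * en x * 2^-1 ^+ n) @ \oo --> 2 * en x * (0 : R).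
    apply: cvgM; first exact: cvg_cst.
    by apply: cvg_expr; rewrite ger0_norm//; lra.
  rewrite mulr0 => /cvgrPdist_lt/(_ _ d0); apply: filterS => n.
  rewrite sub0r normrN; apply: le_lt_trans.
  by rewrite (le_trans _ (ler_norm _))// /e mulrAC.
have NB x : N x + B (N x) = x.
  apply/eqP; rewrite -subr_eq0; apply/eqP/ell1_eq0.
  apply/ler_addgt0Pr => d d0; rewrite add0r.
  have d2 : 0 < d / 2 by rewrite divr_gt0.
  have [n en_d] := filter_ex (e_small x _ d2).
  have -> : N x + B (N x) - x = (N x - s x n) + B (N x - s x n) - P n x.
    rewrite BD BN addrACA -opprD sB opprB.
    by rewrite [P n x - x]addrC addrA addrK.
  apply: le_trans (ell1_sub _ _) _.
  have h1 := ell1_tri (N x - s x n) (B (N x - s x n)).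
  have h2 := B2 (N x - s x n); have h3 := NP x n; have h4 := PB n x.
  move: en_d h3 h4; rewrite /e => en_d h3 h4; lra.
(* As 1 + B is injective, solving the equation determines N, which yields both its linearity and the
   left inverse property. *)
have Nuniq x y : x + B x = y -> N y = x.
  move=> xy; apply/eqP; rewrite -subr_eq0; apply/eqP/Binj.
  by rewrite BD BN addrACA NB -opprD xy subrr.
exists N; split=> //.
- move=> a x y; apply: Nuniq.
  by rewrite BD BZ addrACA -scalerDr !NB.
- by move=> x; have := NP x 0%N; rewrite /s big_geq// subr0 /e expr0 mulr1.
- by move=> x; exact: Nuniq.
Qed.

Section Basis.
Variable X : normedModType C.

Lemma ell1_normE x : `|x| = (en x)%:C.
Proof. by []. Qed.

(** The bounded inverse isomorphism sends the combination back to the finitely supported sequence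
    c. *)
Lemma l1_basis_lower (x : nat -> X) : is_l1_basis x ->
  exists2 K : R, 0 < K & forall N (c : nat -> C),
    (\sum_(n < N) nc (c n))%:C <= K%:C * `|\sum_(n < N) c n *: x n|.
Proof.
move=> [T [S [TK SK Tc Sc Tx]]].
have [K K0 SK'] := continuous_linear_norm_le Sc.
exists K => // N c; apply: le_trans (SK' _).
have -> : S (\sum_(n < N) c n *: x n) = \sum_(n < N) c n *: ell1_unit R n.
  rewrite linear_sum; apply: eq_bigr => n _.
  by rewrite linearZ /= -Tx TK.
rewrite ell1_normE lecR; apply: le_trans (ell1_norm_partial _ N).
rewrite big_mkord; apply: ler_sum => k _.
suff -> : (\sum_(n < N) c n *: ell1_unit R n) k = c k by [].
have evD (y z : ell1) j : (y + z) j = y j + z j by [].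
have ev0 j : (0 : ell1) j = 0 by [].
have -> : forall (F : 'I_N -> ell1) j, (\sum_(n < N) F n) j = \sum_(n < N) F n j.
  by move=> F j; apply: (big_ind2 (fun (y : ell1) a => y j = a)) => // y a z b <- <-.
rewrite (bigD1 k)//= big1 ?addr0.
  by rewrite [LHS](_ : _ = c k * (k == k :> nat)%:R)// eqxx mulr1.
move=> n nk; rewrite [LHS](_ : _ = c n * ((k : nat) == n)%:R)//.
by rewrite eq_sym (negPf nk : (n : nat) == k = false) mulr0.
Qed.

(** The inverse isomorphism sends x_m - x_n to a difference of unit vectors, of norm at least 1.
    This is what makes the disks disjoint. *)
Lemma l1_basis_separated (x : nat -> X) : is_l1_basis x ->
  exists2 d : R, 0 < d & forall m n, m != n -> d%:C <= `|x m - x n|.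
Proof.
move=> [T [S [TK SK Tc Sc Tx]]].
have [K K0 SK'] := continuous_linear_norm_le Sc.
exists K^-1; first by rewrite invr_gt0.
move=> m n mn; have := SK' (x m - x n).
rewrite linearB -!Tx !TK ell1_normE => h.
have K0' : 0 < K%:C by rewrite ltcR.
rewrite -(ler_pM2l K0'); apply: le_trans h.
rewrite -rmorphM mulfV ?gt_eqF// lecR; apply: le_trans (ell1_coef_le _ m).
by rewrite [X in nc X](_ : _ = (m == m)%:R - (m == n)%:R)// eqxx (negPf mn) subr0 Normc.normc1.
Qed.

(* T (1 + B), where T maps the unit vectors to x and B maps the n-th unit
   vector to T^-1 (y n - x n), maps the unit vectors to y. *)
Lemma l1_basis_perturb (x : nat -> X) : is_l1_basis x ->
  exists2 d : R, 0 < d & forall y : nat -> X,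
    (forall n, `|y n - x n| <= d%:C) -> is_l1_basis y.
Proof.
move=> [T [S [TK SK Tc Sc Tx]]].
have [K K0 SK'] := continuous_linear_norm_le Sc.
have [L L0 TL] := continuous_linear_norm_le Tc.
(* With K bounding S, this makes |S (y n - x n)| at most 1/2, as the Neumann series requires. *)
exists (2 * K)^-1; first by rewrite invr_gt0 mulr_gt0.
move=> y yx.
have [|B [lB B2 Bv]] := @ell1_operator (fun n => S (y n - x n)) 2^-1.
  move=> n; rewrite -lecR -ell1_normE (le_trans (SK' _))//.
  have -> : 2^-1 = K * (2 * K)^-1 by field; rewrite gt_eqF.
  by rewrite rmorphM ler_wpM2l// lecR ltW.
have [N [lN N2 NB BN]] := ell1_neumann lB B2.
pose t (z : ell1) : X := T (z + B z); pose u (z : X) : ell1 := N (S z).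
have lt : linear t.
  by move=> a z w; rewrite /t lB -linearP scalerDr addrACA.
have lu : linear u by move=> a z w; rewrite /u linearP lN.
pose t' : {linear ell1 -> X} := HB.pack t (GRing.isLinear.Build _ _ _ _ t lt).
pose u' : {linear X -> ell1} := HB.pack u (GRing.isLinear.Build _ _ _ _ u lu).
exists t', u'; split.
- by move=> z; rewrite /= /u /t TK BN.
- by move=> z; rewrite /= /u /t NB SK.
- apply: (@linear_norm_le_continuous _ _ _ _ (L * (3 / 2))) => z /=.
  rewrite /t (le_trans (TL _))// rmorphM -mulrA ler_wpM2l ?lecR ?(ltW L0)//.
  rewrite !ell1_normE -rmorphM lecR (le_trans (ell1_tri _ _))//.
  by have := B2 z; lra.
- apply: (@linear_norm_le_continuous _ _ _ _ (2 * K)) => z /=.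
  rewrite /u ell1_normE; apply: (@le_trans _ _ (2 * en (S z))%:C); first by rewrite lecR N2.
  have h := SK' z; rewrite ell1_normE in h.
  by rewrite !rmorphM -mulrA; apply: ler_wpM2l h; rewrite lecR.
- by move=> n /=; rewrite /t Bv linearD Tx SK addrC subrK.
Qed.

End Basis.

End Ell1.

(** * From bases of evaluations to interpolating sequences *)

Section Evaluation.
Variable R : realType.
Local Notation C := R[i].
Local Notation nc := (@Normc.normc R).
Variables (Omega : set C) (E : submodClosed (hinf R)).

(** The hypotheses exclude the default values of [insubd] in [evalQ] and of [xget] in
    [extension]. *)
Lemma evalQ_disk (z : C) (h : space_of E) : unit_disk z ->
  (exists g, is_extension Omega h g) -> evaluation Omega E z \in predual_pred E ->
  evalQ Omega E z h = h z.
Proof.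
move=> Dz ex zE; rewrite /evalQ.
rewrite [LHS](_ : _ = evaluation Omega E z h); last first.
  by rewrite -[in RHS](insubdK (0 : predual E) zE).
by have [_] := xgetPex 0 ex; exact.
Qed.

Lemma predual_norm_approx (phi : predual E) (d : R) : 0 < d ->
  exists2 h : space_of E, hinf_norm h <= 1 & predual_norm phi - d < nc (phi h).
Proof.
move=> d0; have [|_ [h h1 <-] hd] := @sup_adherent R
    [set nc (phi h) | h in [set h : space_of E | hinf_norm h <= 1]] d d0.
  split; first by exists (nc (phi 0)), 0 => //; exact: hinf_norm0_le1.
  by exists (predual_norm phi) => _ [k k1 <-]; exact: predual_norm_ub.
by exists h.
Qed.

Lemma predual_sumE N (phi : 'I_N -> predual E) (c : 'I_N -> C) (h : space_of E) :
  (\sum_(n < N) c n *: phi n) h = \sum_(n < N) c n * phi n h.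
Proof. by apply: (big_ind2 (fun (p : predual E) a => p h = a)) => // p a q b <- <-. Qed.

(** The predual norm of a combination of evaluations is a supremum over the unit ball of E, so the
    lower bound of the basis supplies the test functions h. *)
Lemma l1_basis_interpolating (b : nat -> C) :
  (forall n, unit_disk (b n)) ->
  (forall h : hinf R, h \in E -> exists g, is_extension Omega h g) ->
  (forall n, evaluation Omega E (b n) \in predual_pred E) ->
  is_l1_basis (fun n => evalQ Omega E (b n)) -> interpolating b.
Proof.
move=> bD ext bE /l1_basis_lower[K K0 lower].
apply: (@interpolating_of_lower_bound _ E b K (ltW K0) bD) => N c d d0.
have dK : 0 < d / K by rewrite divr_gt0.
pose phi := \sum_(n < N) c n *: evalQ Omega E (b n).
have [h h1 hphi] := predual_norm_approx phi dK; exists h => //.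
have hE : phi h = \sum_(n < N) c n * h (b n).
  rewrite predual_sumE; apply: eq_bigr => n _; rewrite evalQ_disk//.
  by apply: ext; exact: (valP h).
have : (\sum_(n < N) nc (c n))%:C <= K%:C * (predual_norm phi)%:C := lower N c.
rewrite -rmorphM lecR -hE lerBlDr => /le_trans; apply.
have -> : d = K * (d / K) by rewrite mulrC divfK// gt_eqF.
by rewrite -mulrDr ler_wpM2l ?(ltW K0)// -lerBlDr ltW.
Qed.

End Evaluation.

Theorem theorem3p9 (R : realType) (Omega : set R[i])
    (E : submodClosed (hinf R)) (a : nat -> R[i])
    (Omega_ge : unit_disk `<=` Omega)
    (Omega_le : Omega `<=` cdisk 0 1)
    (E_closed : closed ([set h | h \in E] : set (weakstar R)))
    (E_ext : forall h : hinf R, h \in E ->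
       exists g : R[i] -> R[i], is_extension Omega h g)
    (ev_predual : forall z, Omega z -> evaluation Omega E z \in predual_pred E)
    (ev_continuous : {within Omega, continuous (evalQ Omega E)})
    (a_mem : forall n, (unit_circle `&` Omega) (a n))
    (a_basis : is_l1_basis (fun n => evalQ Omega E (a n))) :
  exists tau : nat -> R,
    [/\ forall n, 0 < tau n,
        trivIset setT (fun n => cdisk (a n) (tau n)) &
        forall b : nat -> R[i],
          (forall n, (unit_disk `&` disk (a n) (tau n)) (b n)) ->
          is_l1_basis (fun n => evalQ Omega E (b n)) /\ interpolating b].
Proof.
have [d1 d1_gt0 sep] := l1_basis_separated a_basis.
have [d2 d2_gt0 pert] := l1_basis_perturb a_basis.
(* Closeness within d1 is used for disjointness, within d2 for the perturbation. *)
have d_gt0 : 0 < (Num.min d1 d2)%:C by rewrite ltcR lt_min d1_gt0.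
have /choice[r rP] : forall n, exists r : R, 0 < r /\ forall z, Omega z ->
    Normc.normc (z - a n) < r ->
    `|evalQ Omega E (a n) - evalQ Omega E z| < (Num.min d1 d2)%:C.
  move=> n; have Oa := (a_mem n).2.
  have /cvgrPdist_lt/(_ _ d_gt0) := ev_continuous (a n).
  rewrite {1}/nbhs/= -nbhs_subspace_in// => /nbhs_normcP[e e0 he].
  by exists e; split => // z Oz /he; exact.
have r_gt0 n := (rP n).1; have rE n := (rP n).2.
(* If two disks meet and r_j <= r_i, then |a_j - a_i| <= 2 r_i / 3 < r_i, so the evaluations at a_i
   and a_j are closer than d1, which forces i = j. *)
exists (fun n => r n / 3); split.
- by move=> n; rewrite divr_gt0.
- move=> i j _ _ [z [zi zj]].
  wlog rij : i j zi zj / r j <= r i.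
    by move=> wl; have [|/ltW] := leP (r j) (r i); [exact: wl|move/(wl j i zj zi)].
  have : Normc.normc (a j - a i) < r i.
    move: zi zj; rewrite /cdisk /= !normc_le => zi zj.
    have := normc_tri (a j) z (a i); rewrite (normc_distC (a j) z).
    by have := r_gt0 i; lra.
  move=> /(rE i _ (a_mem j).2) Eij; apply/eqP; apply: contraT => /sep sij.
  have : d1%:C < (Num.min d1 d2)%:C := le_lt_trans sij Eij.
  by rewrite ltcR lt_min ltxx.
move=> b bP; have bD n : unit_disk (b n) := (bP n).1.
have b_basis : is_l1_basis (fun n => evalQ Omega E (b n)).
  apply: pert => n; rewrite distrC ltW//.
  have ba : Normc.normc (b n - a n) < r n.
    have [_] := bP n; rewrite /disk /= Defs.normcE ltcR; have := r_gt0 n; lra.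
  have := rE n _ (Omega_ge _ (bD n)) ba => /lt_le_trans; apply.
  by rewrite lecR ge_min lexx orbT.
split=> //; apply: l1_basis_interpolating b_basis => // n.
by apply: ev_predual; exact: Omega_ge.
Qed.
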